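(* Let $G$ be a connected claw-free graph and let $k \geq 2$ be an integer. If $\sigma_{3k+3}(G) \geq |G| - k$, then $G$ has a spanning tree whose reducible stem has at most $k$ leaves.
   Context: All graphs are finite, without loops or multiple edges. $|G|$ denotes the number of vertices of $G$. A graph is claw-free if it contains no $K_{1,3}$ as an induced subgraph. For an integer $p \geq 2$, $\sigma_p(G)$ is the minimum of $\sum_{x \in S} \deg_G(x)$ over all independent sets $S \subseteq V(G)$ with $|S| = p$ (i.e. sets of $p$ pairwise non-adjacent vertices); by convention $\sigma_p(G) = +\infty$ if $G$ has no independent set of $p$ vertices. Let $T$ be a tree. A leaf of $T$ is a vertex of degree one in $T$, and a branch vertex of $T$ is a vertex of degree at least three in $T$. For distinct vertices $u,v$ of $T$, $P_T[u,v]$ is the unique path in $T$ connecting $u$ and $v$. For a leaf $x$ of $T$, let $y_x$ be the branch vertex of $T$ nearest to $x$, and let $P_T[x,y_x)$ be the path connecting $x$ to $y_x$ in $T$ but not containing $y_x$ (that is, $P_T[x,y_x]$ with $y_x$ removed). The reducible stem of $T$ is the subtree of $T$ obtained by removing the (vertices of the) path $P_T[x,y_x)$ for every leaf $x$ of $T$. The leaves of the reducible stem are its vertices of degree one in the reducible stem. If $T$ has no branch vertex (i.e. $T$ is a path), the reducible stem is taken to be empty, and so it has no leaves. *)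

(* Defs.v *)
From mathcomp Require Import all_boot all_order all_algebra.
From mathcomp Require Import constructive_ereal.

Set Implicit Arguments.
Unset Strict Implicit.
Unset Printing Implicit Defensive.

(* A graph is given by a finType V of vertices and its adjacency relation on  *)
(* V, a symmetric irreflexive relation.                                       *)

Definition simple_graph (V : finType) (e : rel V) : Prop :=
  symmetric e /\ irreflexive e.

(* The graph with no vertices does not count as connected. *)
Definition connected_graph (V : finType) (e : rel V) : Prop :=
  0 < #|V| /\ forall x y : V, connect e x y.

Definition deg (V : finType) (e : rel V) (x : V) : nat := #|[set y | e x y]|.

Definition induced_subgraph (W V : finType) (h : rel W) (e : rel V) : Prop :=
  exists f : W -> V, injective f /\ {mono f : i j / h i j >-> e i j}.

(* K_{1,3}, with centre 0. *)
Definition K13 : rel 'I_4 :=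
  fun i j => (i == 0 :> nat) (+) (j == 0 :> nat).

Definition claw_free (V : finType) (e : rel V) : Prop :=
  ~ induced_subgraph K13 e.

Definition independent (V : finType) (e : rel V) (S : {set V}) : bool :=
  [forall x in S, forall y in S, ~~ e x y].

(* Valued in the extended integers, so that the minimum over the empty family *)
(* is +oo.                                                                    *)
Definition sigma (V : finType) (e : rel V) (p : nat) : \bar int :=
  \big[Order.min/+oo%E]_(S : {set V} | independent e S && (#|S| == p))
    ((\sum_(x in S) deg e x)%N%:Z)%:E.

Definition acyclic (V : finType) (t : rel V) : Prop :=
  forall p : seq V, 2 < size p -> ~ ucycle t p.

Definition tree (V : finType) (t : rel V) : Prop :=
  [/\ simple_graph t, connected_graph t & acyclic t].

Definition spanning_tree (V : finType) (e t : rel V) : Prop :=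
  tree t /\ subrel t e.

Definition leaf (V : finType) (t : rel V) (x : V) : bool := deg t x == 1.

Definition branch (V : finType) (t : rel V) (x : V) : bool := 3 <= deg t x.

(* The vertices of P_T[u,v] after u, listed from u to v. In a tree the        *)
(* sequence picked exists and is unique; its size is then the distance from u *)
(* to v.                                                                      *)
Definition tpath_tail (V : finType) (t : rel V) (u v : V) : seq V :=
  if [pick p : {bseq #|V| of V} |
       [&& path t u p, uniq (u :: p) & last u p == v]] is Some p
  then p else [::].

Definition tpath (V : finType) (t : rel V) (u v : V) : seq V :=
  u :: tpath_tail t u v.

Definition tdist (V : finType) (t : rel V) (u v : V) : nat :=
  size (tpath_tail t u v).

Definition nearest_branch (V : finType) (t : rel V) (x y : V) : bool :=
  branch t y && [forall z, branch t z ==> (tdist t x y <= tdist t x z)].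

(* The vertices of P_T[x,y_x). The nearest branch vertex y_x of a leaf x of a *)
(* tree is unique if there is a branch vertex at all.                         *)
Definition leaf_path (V : finType) (t : rel V) (x : V) : {set V} :=
  [set w | [exists y, [&& nearest_branch t x y, w \in tpath t x y & w != y]]].

(* The vertex set of the reducible stem, which is the subgraph of the tree    *)
(* induced by this set.                                                       *)
Definition reducible_stem (V : finType) (t : rel V) : {set V} :=
  if [exists y, branch t y]
  then [set: V] :\: \bigcup_(x | leaf t x) leaf_path t x
  else set0.

(* The leaves of the subgraph of t induced by S. *)
Definition leaves_in (V : finType) (t : rel V) (S : {set V}) : {set V} :=
  [set v in S | #|[set w in S | t v w]| == 1].

(* Main.v *)
Require Import Defs.
From mathcomp Require Import all_boot all_order all_algebra.
From mathcomp Require Import constructive_ereal.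
From mathcomp Require Import zify.
From Stdlib Require Import Classical_Prop.

Set Implicit Arguments.
Unset Strict Implicit.
Unset Printing Implicit Defensive.

(* Cover V by a tree t on a vertex set R together with vertex-disjoint paths
   outside R, each with its first vertex adjacent to R. Choose such a cover
   minimizing lexicographically the number of leaves of t, then #|R|, then the
   number of paths, then the number of paths whose last vertex has no neighbor
   in R.

   By minimality every leaf b of t carries at least two private paths, that is,
   paths that cannot be attached to R at any vertex other than b. Therefore
   hanging the paths on t gives a spanning tree whose reducible stem has at most
   as many leaves as t, and we are done if t has at most k leaves. If t had more
   than k leaves, let S consist of these leaves and of the free ends of all
   their private paths. S is independent, as an edge inside S would allow two
   paths to be merged or two leaves of t to be eliminated. Claw-freeness makes
   the closed neighborhoods in R of the leaves pairwise disjoint, the free ends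
   have no neighbor in R, and on a hanging path Q the neighbors of S number at
   most the size of Q: a neighbor q of the free end of Q is charged to the
   successor of q, every other incidence to q itself, and two charges to the
   same vertex would yield a smaller cover. Hence the degrees of S sum up to at
   most #|V| - k - 1, although #|S| >= 3k + 3. *)

(** * Connectivity and edge counts of a symmetric relation *)

Section Relations.

Variable V : finType.
Implicit Types (t e : rel V) (R U : {set V}) (x y u v w b : V).

Lemma connect_exit t U x y : connect t x y -> x \in U -> y \notin U ->
  exists a b, [/\ a \in U, b \notin U & t a b].
Proof.
case/connectP=> p; elim: p x => [|z p IH] x /=.
  by move=> _ -> ->.
case/andP=> txz pz yE xU yU; case: (boolP (z \in U)) => zU.
  exact: IH pz yE zU yU.
by exists x, z.
Qed.

Definition same_pair u w x y := ((x == u) && (y == w)) || ((x == w) && (y == u)).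

Lemma same_pairC u w x y : same_pair u w y x = same_pair u w x y.
Proof.
by rewrite /same_pair orbC andbC [X in _ || X]andbC.
Qed.

Definition del_edge t u w : rel V := fun x y => t x y && ~~ same_pair u w x y.
Definition add_edge t u w : rel V := fun x y => t x y || same_pair u w x y.

Lemma del_edge_sym t u w : symmetric t -> symmetric (del_edge t u w).
Proof. by move=> st x y; rewrite /del_edge st same_pairC. Qed.

Lemma add_edge_sym t u w : symmetric t -> symmetric (add_edge t u w).
Proof. by move=> st x y; rewrite /add_edge st same_pairC. Qed.

Lemma del_edgeC t u w : del_edge t u w =2 del_edge t w u.
Proof. by move=> x y; rewrite /del_edge /same_pair orbC. Qed.

Lemma path_del_edge t u w x p :
  path t x p -> (u \notin x :: p) || (w \notin x :: p) -> path (del_edge t u w) x p.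
Proof.
elim: p x => //= y p IH x /andP[txy py] H; apply/andP; split.
  rewrite /del_edge txy /=; apply/negP=> /orP[]/andP[/eqP xE /eqP yE];
  by move: H; rewrite xE yE !inE !eqxx ?orbT.
apply: IH => //; move: H; rewrite !(in_cons x) !negb_or.
by case/orP=> /andP[_ ->]; rewrite ?orbT.
Qed.

(* Ordered pairs: every edge of a symmetric t is counted twice. *)
Definition edges t := [set p : V * V | t p.1 p.2].

(** Grow a vertex set inside [R] from one vertex: connectivity supplies an edge leaving it, and each
    added vertex brings two new ordered pairs. *)
Lemma card_edges_connected t R : symmetric t -> irreflexive t ->
  (forall x y, t x y -> x \in R) ->
  {in R &, forall x y, connect t x y} -> (#|R| - 1).*2 <= #|edges t|.
Proof.
move=> st it tR conn.
have grow n : n < #|R| -> exists U, [/\ U \subset R, #|U| = n.+1 &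
    n.*2 <= #|[set p in edges t | (p.1 \in U) && (p.2 \in U)]|].
  elim: n => [|n IH] nR.
    case/card_gt0P: nR => r rR; exists [set r].
    by rewrite sub1set rR cards1.
  have [U [UR cU eU]] := IH (ltnW nR).
  have [x xU] : exists x, x \in U by apply/card_gt0P; rewrite cU.
  have [y] : exists y, y \in R :\: U.
    by apply/card_gt0P; rewrite cardsD (setIidPr UR) cU subn_gt0.
  rewrite inE => /andP[yU yR].
  have [a [b [aU bU tab]]] := connect_exit (conn _ _ (subsetP UR _ xU) yR) xU yU.
  have bR : b \in R by apply: (tR b a); rewrite st.
  exists (b |: U); split.
  - by rewrite subUset sub1set bR.
  - by rewrite cardsU1 bU cU.
  set E := [set p in edges t | _] in eU; set E' := [set p in edges t | _].
  have sub : (a, b) |: ((b, a) |: E) \subset E'.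
    apply/subsetP=> -[c d]; rewrite !inE !xpair_eqE /=.
    case/orP=> [/andP[/eqP-> /eqP->]|/orP[/andP[/eqP-> /eqP->]|]].
    - by rewrite tab aU eqxx orbT.
    - by rewrite st tab aU eqxx orbT.
    by case/and3P=> -> -> ->; rewrite !orbT.
  apply: leq_trans (subset_leq_card sub).
  rewrite !cardsU1 !inE !xpair_eqE /= (negbTE bU) !andbF !orbF.
  case: (eqVneq a b) => [ab|_]; first by rewrite -ab aU in bU.
  by rewrite /= doubleS !add1n !ltnS.
case: (posnP #|R|) => [-> //|R0].
have [|U [UR cU eU]] := grow #|R|.-1; first by lia.
rewrite subn1; apply: leq_trans eU _; apply: subset_leq_card.
by apply/subsetP=> p; rewrite inE => /andP[].
Qed.

End Relations.

(** * Subtrees of the graph: edge exchanges and number of leaves *)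

Section Trees.

Variables (V : finType) (e : rel V).
Hypotheses (e_sym : symmetric e) (e_irr : irreflexive e).
Implicit Types (t : rel V) (R U : {set V}) (x y u v w b : V).

(** Being a tree is encoded by connectivity and an edge count instead of acyclicity, so that local
    modifications only require counting edges. The bound is twice [#|R| - 1] because [edges]
    contains both orientations. *)
Record tree_on t R : Prop := TreeOn {
  tree_sym : symmetric t;
  tree_sub : subrel t e;
  tree_dom : forall x y, t x y -> x \in R;
  tree_conn : {in R &, forall x y, connect t x y};
  tree_gt0 : 0 < #|R|;
  tree_card : #|edges t| <= (#|R| - 1).*2 }.

Lemma tree_irr t R : tree_on t R -> irreflexive t.
Proof. by move=> T x; apply/negbTE/negP=> /(tree_sub T); rewrite e_irr. Qed.

Lemma tree_domr t R x y : tree_on t R -> t x y -> y \in R.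
Proof. by move=> T; rewrite (tree_sym T) => /(tree_dom T). Qed.

Lemma tree_del_card t R u w : tree_on t R -> t u w ->
  #|edges (del_edge t u w)| + 2 <= #|edges t|.
Proof.
move=> T tuw.
have sub : (u, w) |: ((w, u) |: edges (del_edge t u w)) \subset edges t.
  apply/subsetP=> -[c d]; rewrite !inE !xpair_eqE /=.
  case/orP=> [/andP[/eqP-> /eqP->] //|/orP[/andP[/eqP-> /eqP->]|/andP[] //]].
  by rewrite (tree_sym T).
apply: leq_trans (subset_leq_card sub).
rewrite !cardsU1 !inE !xpair_eqE /= /del_edge /same_pair !eqxx /= !orbT !andbF !orbF.
case: (eqVneq u w) => [uw|_ /=]; last by lia.
by move: tuw; rewrite uw (tree_irr T).
Qed.

Lemma del_edge_connect t R u w b x : tree_on t R -> t u w -> connect t b x ->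
  [|| connect (del_edge t u w) b x, connect (del_edge t u w) b u
    | connect (del_edge t u w) b w].
Proof.
move=> T tuw cbx; apply/negPn/negP; rewrite !negb_or => /and3P[nx nu nw].
have := @connect_exit _ t [set y | connect (del_edge t u w) b y] b x cbx.
rewrite !inE connect0 => /(_ isT nx) [a [d []]]; rewrite !inE => ca nd tad.
case: (boolP (same_pair u w a d)) => [/orP[]/andP[/eqP aE _]|nS].
- by rewrite aE (negbTE nu) in ca.
- by rewrite aE (negbTE nw) in ca.
by case/negP: nd; apply: connect_trans ca (connect1 _); rewrite /del_edge tad.
Qed.

(** Otherwise deleting the edge would keep [R] connected with two ordered pairs fewer, below the
    bound of [card_edges_connected]. *)
Lemma tree_bridge t R u w : tree_on t R -> t u w -> ~~ connect (del_edge t u w) u w.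
Proof.
move=> T tuw; apply/negP=> cuw.
have ds := del_edge_sym u w (tree_sym T).
have cs := sym_connect_sym ds.
have sub : subrel (connect t) (connect (del_edge t u w)).
  apply: connect_sub => x y txy.
  case: (boolP (same_pair u w x y)) => [/orP[]/andP[/eqP-> /eqP->] //|nS].
    by rewrite cs.
  by apply: connect1; rewrite /del_edge txy.
have := @card_edges_connected V (del_edge t u w) R ds.
have di : irreflexive (del_edge t u w).
  by move=> x; rewrite /del_edge (tree_irr T).
have dR x y : del_edge t u w x y -> x \in R by case/andP=> /(tree_dom T).
move=> /(_ di dR (fun x y xR yR => sub _ _ (tree_conn T xR yR))).
have := tree_del_card T tuw; have := tree_card T; lia.
Qed.

Lemma deg_del_edge t R u w x : tree_on t R -> t u w ->
  deg (del_edge t u w) x + ((x == u) || (x == w)) = deg t x.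
Proof.
move=> T tuw; have twu : t w u by rewrite (tree_sym T).
have nuw : u != w by apply: contraTneq tuw => ->; rewrite (tree_irr T).
rewrite /deg; case: (eqVneq x u) => [->|xu] /=.
  rewrite (cardsD1 w [set y | t u y]) inE tuw addnC; congr (_ + _).
  apply: eq_card => y; rewrite !inE /del_edge /same_pair eqxx (negbTE nuw) /=.
  by rewrite orbF andbC.
case: (eqVneq x w) => [->|xw] /=.
  rewrite (cardsD1 u [set y | t w y]) inE twu addnC; congr (_ + _).
  apply: eq_card => y; rewrite !inE /del_edge /same_pair eqxx.
  by rewrite eq_sym (negbTE nuw) /= andbC.
rewrite addn0; apply: eq_card => y.
by rewrite !inE /del_edge /same_pair (negbTE xu) (negbTE xw) andbT.
Qed.

Lemma deg_add_edge t u w x : symmetric t -> ~~ t u w -> u != w ->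
  deg (add_edge t u w) x = deg t x + ((x == u) || (x == w)).
Proof.
move=> st ntuw nuw; have ntwu : ~~ t w u by rewrite st.
rewrite /deg; case: (eqVneq x u) => [->|xu] /=.
  have -> : [set y | add_edge t u w u y] = w |: [set y | t u y].
    by apply/setP=> y; rewrite !inE /add_edge /same_pair eqxx (negbTE nuw) orbF orbC.
  by rewrite cardsU1 inE ntuw addnC.
case: (eqVneq x w) => [->|xw] /=.
  have -> : [set y | add_edge t u w w y] = u |: [set y | t w y].
    by apply/setP=> y; rewrite !inE /add_edge /same_pair eqxx (eq_sym w) (negbTE nuw) orbC.
  by rewrite cardsU1 inE ntwu addnC.
rewrite addn0; apply: eq_card => y.
by rewrite !inE /add_edge /same_pair (negbTE xu) (negbTE xw) orbF.
Qed.

Lemma card_edges_add t u w : #|edges (add_edge t u w)| <= #|edges t| + 2.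
Proof.
have sub : edges (add_edge t u w) \subset (u, w) |: ((w, u) |: edges t).
  apply/subsetP=> -[c d]; rewrite !inE !xpair_eqE /= /add_edge /same_pair.
  by case/orP=> [->|/orP[->|->]]; rewrite ?orbT.
apply: leq_trans (subset_leq_card sub) _; rewrite !cardsU1.
by case: (_ \in _); case: (_ \in _); rewrite /=; lia.
Qed.

(** [v] and [v'] lie on the two sides of the bridge [u w], so the new edge reconnects them and the
    edge bound is preserved. Degrees are compared additively to avoid truncated subtraction. *)
Lemma tree_exchange t R u w v v' : tree_on t R -> t u w -> e v v' ->
    connect (del_edge t u w) u v -> connect (del_edge t u w) w v' ->
  tree_on (add_edge (del_edge t u w) v v') R /\
  forall x, deg (add_edge (del_edge t u w) v v') x + ((x == u) || (x == w))
            = deg t x + ((x == v) || (x == v')).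
Proof.
move=> T tuw evv cuv cwv; set c := del_edge t u w; set t' := add_edge c v v'.
have sc : symmetric c := del_edge_sym u w (tree_sym T).
have csc := sym_connect_sym sc.
have st' : symmetric t' := add_edge_sym v v' sc.
have cst' := sym_connect_sym st'.
have nvv : v != v' by apply: contraTneq evv => ->; rewrite e_irr.
have ncvv : ~~ c v v'.
  apply/negP=> /connect1 cvv; case/negP: (tree_bridge T tuw).
  by apply: connect_trans cuv (connect_trans cvv _); rewrite csc.
have inR x y : connect c x y -> x \in R -> y \in R.
  move=> cxy xR; apply/negPn/negP=> yR.
  have [a [d [_ dR /andP[tad _]]]] := connect_exit cxy xR yR.
  by rewrite (tree_domr T tad) in dR.
have vR := inR _ _ cuv (tree_dom T tuw).
have v'R := inR _ _ cwv (tree_domr T tuw).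
have subc : subrel (connect c) (connect t').
  by apply: connect_sub => x y cxy; apply: connect1; rewrite /t' /add_edge cxy.
have cuw : connect t' u w.
  apply: connect_trans (subc _ _ cuv) _; rewrite cst'.
  apply: connect_trans (subc _ _ cwv) (connect1 _).
  by rewrite st' /t' /add_edge /same_pair !eqxx orbT.
split; last first.
  move=> x; rewrite deg_add_edge // -(deg_del_edge x T tuw) -/c.
  by rewrite addnAC.
split=> //.
- move=> x y /orP[/andP[/(tree_sub T)] //|/orP[]/andP[/eqP-> /eqP->] //].
  by rewrite e_sym.
- move=> x y /orP[/andP[/(tree_dom T)] //|].
  by case/orP=> /andP[/eqP-> _].
- move=> x y xR yR; have := tree_conn T xR yR.
  apply: connect_sub => a d tad.
  case: (boolP (same_pair u w a d)) => [/orP[]/andP[/eqP-> /eqP->] //|nS].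
    by rewrite cst'.
  by apply/subc/connect1; rewrite /c /del_edge tad.
- exact: tree_gt0 T.
have := tree_del_card T tuw; have := card_edges_add c v v'; have := tree_card T.
rewrite -/c -/t'; lia.
Qed.

Lemma tree_pendant t R u y : tree_on t R -> u \in R -> y \notin R -> e u y ->
  tree_on (add_edge t u y) (y |: R) /\
  forall x, deg (add_edge t u y) x = deg t x + ((x == u) || (x == y)).
Proof.
move=> T uR yR euy; set t' := add_edge t u y.
have st' : symmetric t' := add_edge_sym u y (tree_sym T).
have cst' := sym_connect_sym st'.
split; last first.
  move=> x; apply: deg_add_edge (tree_sym T) _ _.
    by apply: contra yR => /(tree_domr T).
  by apply: contraTneq euy => ->; rewrite e_irr.
have cu x : x \in y |: R -> connect t' u x.
  rewrite !inE => /orP[/eqP->|xR].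
    by apply: connect1; rewrite /t' /add_edge /same_pair !eqxx orbT.
  have := tree_conn T uR xR; apply: connect_sub => a d tad.
  by apply: connect1; rewrite /t' /add_edge tad.
split=> //.
- move=> x z /orP[/(tree_sub T) //|/orP[]/andP[/eqP-> /eqP->] //].
  by rewrite e_sym.
- move=> x z; rewrite !inE => /orP[/(tree_dom T) ->|]; first by rewrite orbT.
  by case/orP=> /andP[/eqP-> _]; rewrite ?uR ?eqxx ?orbT.
- by move=> x z xR zR; apply: connect_trans (cu _ zR); rewrite cst' cu.
- by rewrite cardsU1 yR.
have := card_edges_add t u y; have := tree_card T; have := tree_gt0 T.
rewrite cardsU1 yR -/t'; lia.
Qed.

Lemma leaf_nbr t x : leaf t x -> exists2 f, t x f & forall y, t x y -> y = f.
Proof.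
case/cards1P=> f E; exists f; first by have := set11 f; rewrite -E inE.
by move=> y txy; apply/set1P; rewrite -E inE.
Qed.

Lemma leaf_dom t R x : tree_on t R -> leaf t x -> x \in R.
Proof. by move=> T /leaf_nbr[f /(tree_dom T)]. Qed.

Lemma tree_del_leaf t R b f : tree_on t R -> leaf t b -> t b f ->
  tree_on (del_edge t b f) (R :\ b).
Proof.
move=> T lb tbf; set c := del_edge t b f.
have [f' _ Uf'] := leaf_nbr lb; have ff' := Uf' _ tbf; rewrite -{}ff' in Uf'.
have sc : symmetric c := del_edge_sym b f (tree_sym T).
have csc := sym_connect_sym sc.
have cb x : ~~ c b x.
  apply/negP=> /andP[/Uf'-> ]; by rewrite /same_pair !eqxx.
have nbf : f != b by apply: contraTneq tbf => ->; rewrite (tree_irr T).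
have cf x : x \in R :\ b -> connect c f x.
  rewrite !inE => /andP[xb xR]; rewrite csc.
  have := del_edge_connect T tbf (tree_conn T xR xR); rewrite -/c.
  have ncb : ~~ connect c x b.
    rewrite csc; apply/negP=> /connectP[[|y p] /= py E].
      by rewrite E eqxx in xb.
    by move: py; rewrite (negbTE (cb y)).
  rewrite connect0 (negbTE ncb) /=.
  have := del_edge_connect T tbf (tree_conn T xR (tree_domr T tbf)); rewrite -/c.
  by rewrite (negbTE ncb) /= orbb.
split=> //.
- by move=> x y /andP[/(tree_sub T)].
- move=> x y cxy; rewrite !inE; have /andP[/(tree_dom T) -> _] := cxy.
  by rewrite andbT; apply: contraTneq cxy => ->.
- by move=> x y xR yR; apply: connect_trans (cf _ yR); rewrite csc cf.
- by apply/card_gt0P; exists f; rewrite !inE nbf (tree_domr T tbf).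
have := tree_del_card T tbf; rewrite -/c; have := tree_card T.
have := cardsD1 b R; rewrite (tree_dom T tbf) => ->; lia.
Qed.

Definition lam t := #|[set x | leaf t x]|.

Lemma lam_del_leaf t R b f : tree_on t R -> leaf t b -> t b f ->
  lam (del_edge t b f) <= lam t.
Proof.
move=> T lb tbf.
have sub : [set x | leaf (del_edge t b f) x] \subset f |: ([set x | leaf t x] :\ b).
  apply/subsetP=> x; rewrite !inE /leaf => /eqP lx.
  have := deg_del_edge x T tbf; rewrite lx.
  case: (eqVneq x f) => //= _; case: (eqVneq x b) => [->|_] /=.
    by move: lb => /eqP->.
  by move=> <-.
apply: leq_trans (subset_leq_card sub) _; rewrite cardsU1.
by have := cardsD1 b [set x | leaf t x]; rewrite inE lb /lam; case: (_ \notin _); lia.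
Qed.

Lemma lam_pendant t R u y : tree_on t R -> leaf t u -> y \notin R -> e u y ->
  leaf (add_edge t u y) y /\ lam (add_edge t u y) = lam t.
Proof.
move=> T lu yR euy; have [T' dT'] := tree_pendant T (leaf_dom T lu) yR euy.
have uR := leaf_dom T lu.
have nuy : u != y by apply: contraNneq yR => <-.
have dy : deg t y = 0.
  apply: eq_card0 => z; rewrite inE; apply: contraNF yR; exact: tree_dom T _ _.
have E : [set x | leaf (add_edge t u y) x] = y |: ([set x | leaf t x] :\ u).
  apply/setP=> x; rewrite !inE /leaf dT'.
  case: (eqVneq x y) => [->|xy] /=; first by rewrite dy orbT.
  case: (eqVneq x u) => [->|xu] /=; first by move: lu => /eqP->.
  by rewrite addn0.
split; first by have := setU11 y ([set x | leaf t x] :\ u); rewrite -E inE.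
rewrite /lam E cardsU1 !inE /leaf dy eq_sym nuy /= [RHS](cardsD1 u) inE.
by move: lu; rewrite /leaf => ->.
Qed.

Lemma spanning_tree_exists : 0 < #|V| -> (forall x y, connect e x y) ->
  exists t, tree_on t [set: V].
Proof.
move=> V0 conn.
suff grow n : n < #|V| -> exists t U, tree_on t U /\ #|U| = n.+1.
  have [|t [U [T cU]]] := grow #|V|.-1; first by lia.
  exists t; suff <- : U = [set: V] by [].
  by apply/eqP; rewrite eqEcard subsetT cU cardsT; lia.
elim: n => [|n IH] nV.
  case/card_gt0P: V0 => r _; exists (fun _ _ => false), [set r].
  split; last by rewrite cards1.
  split=> //; rewrite ?cards1 //.
    by move=> x y /set1P-> /set1P->; apply: connect0.
  by rewrite leqn0 cards_eq0; apply/eqP/setP=> p; rewrite !inE.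
have [t [U [T cU]]] := IH (ltnW nV).
have [x xU] : exists x, x \in U by apply/card_gt0P; rewrite cU.
have [y] : exists y, y \in ~: U.
  by apply/card_gt0P; rewrite cardsCs setCK cU; lia.
rewrite inE => yU.
have [a [b [aU bU eab]]] := connect_exit (conn x y) xU yU.
exists (add_edge t a b), (b |: U); split; last by rewrite cardsU1 bU cU.
by case: (tree_pendant T aU bU eab).
Qed.

(** On the path from [b] to [b'], let [a] be a vertex where a walk to a third leaf [x] departs. Its
    predecessor, its successor [w] and the departing neighbor give it degree three, and cutting
    [a w] leaves [b] on the side of [a] and [b'] on the side of [w]. *)
Lemma tree_branch_between t R b b' : tree_on t R -> leaf t b -> leaf t b' ->
    b != b' -> 2 < lam t ->
  exists u w, [/\ t u w, 2 < deg t u, connect (del_edge t u w) u b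
                & connect (del_edge t u w) w b'].
Proof.
move=> T lb lb' nbb l3.
have [x] : exists x, x \in [set x | leaf t x] :\ b :\ b'.
  apply/card_gt0P; have := cardsD1 b' ([set x | leaf t x] :\ b).
  have := cardsD1 b [set x | leaf t x]; rewrite !inE lb lb'.
  by rewrite /lam in l3; move: (eq_sym b b'); case: (b' == b); lia.
rewrite !inE => /and3P[xb' xb lx].
have bR := leaf_dom T lb; have b'R := leaf_dom T lb'.
have [p0 pp0 Ep0] := connectP (tree_conn T bR b'R).
case/shortenP: pp0 Ep0 => p pp up _ Ep {p0}.
have st := tree_sym T.
have inner p1 a w p2 : p = p1 ++ a :: w :: p2 ->
    [/\ t a (last b p1), t a w & last b p1 != w].
  move=> pE; move: pp; rewrite pE cat_path /= => /and4P[_ tla taw _].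
  rewrite st tla taw; split=> //.
  move: up; rewrite pE -cat_cons cat_uniq => /and3P[_ H _].
  apply: contra H => /eqP lw; apply/hasP; exists w; first by rewrite !inE eqxx orbT.
  by rewrite /= -lw mem_last.
have xp : x \notin b :: p.
  rewrite inE (negbTE xb) /=; apply/negP=> /splitPr pE.
  case: p / pE pp up Ep inner => p1 [|w p2] pp up Ep inner.
    by rewrite last_cat /= in Ep; rewrite Ep eqxx in xb'.
  have [ta1 ta2] := inner _ _ _ _ erefl.
  by have [f _ Uf] := leaf_nbr lx; rewrite (Uf _ ta1) (Uf _ ta2) eqxx.
have xR := leaf_dom T lx.
have [a [d []]] := @connect_exit _ t [set y in b :: p] b x (tree_conn T bR xR)
   ltac:(by rewrite !inE eqxx) ltac:(by rewrite inE).
rewrite inE => ap; rewrite inE => dp tad.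
have ab : a != b.
  apply: contraNneq dp => aE; rewrite aE in tad.
  have [f _ Uf] := leaf_nbr lb; rewrite (Uf _ tad).
  case: p pp Ep {up inner xp ap} => [|z p] /=.
    by move=> _ E; rewrite E eqxx in nbb.
  by case/andP=> /Uf-> _ _; rewrite !inE eqxx orbT.
move: ap; rewrite inE (negbTE ab) /= => /splitPr pE.
case: p / pE pp up Ep inner xp dp => p1 [|w p2] pp up Ep inner xp dp.
  rewrite last_cat /= in Ep; move: pp; rewrite cat_path /= => /and3P[_ tla _].
  have [f _ Uf] := leaf_nbr lb'; rewrite Ep in Uf.
  have lE : last b p1 = f by apply: Uf; rewrite st.
  have dE : d = f := Uf _ tad.
  by case/negP: dp; rewrite dE -lE -cat_cons mem_cat mem_last.
have [ta1 ta2 nl] := inner _ _ _ _ erefl.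
exists a, w; split=> //.
- apply: leq_trans (_ : #|last b p1 |: (w |: [set d])| <= _).
    rewrite !cardsU1 cards1 !inE.
    have dl : last b p1 != d.
      apply: contraNneq dp => <-; by rewrite -cat_cons mem_cat mem_last.
    have dw : d != w.
      by apply: contraNneq dp => ->; rewrite -cat_cons mem_cat !inE eqxx !orbT.
    by rewrite (negbTE nl) (negbTE dl) (eq_sym w) (negbTE dw).
  apply: subset_leq_card; apply/subsetP=> z; rewrite !inE.
  by case/orP=> [|/orP[]] /eqP->.
- rewrite (sym_connect_sym (del_edge_sym _ _ st)).
  apply/connectP; exists (rcons p1 a); last by rewrite last_rcons.
  apply: path_del_edge.
    by move: pp; rewrite -cat_rcons cat_path => /andP[].
  apply/orP; right; move: up; rewrite -cat_rcons -cat_cons cat_uniq.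
  by case/and3P=> _ /= /norP[-> _].
apply/connectP; exists p2; last by rewrite Ep last_cat.
apply: path_del_edge.
  by move: pp; rewrite cat_path /= => /and4P[].
apply/orP; left; move: up; rewrite /= cat_uniq /=.
by case/and5P=> _ _ _ ->.
Qed.

(** Add [b b'] and delete an edge [u w] at a branch vertex between them: [b] and [b'] gain a
    neighbor, [u] keeps degree at least two, so at most [w] is added to the leaves other than [b]
    and [b']. *)
Lemma leaf_join t R b b' : tree_on t R -> leaf t b -> leaf t b' ->
  e b b' -> 2 < lam t -> exists2 t', tree_on t' R & lam t' < lam t.
Proof.
move=> T lb lb' ebb l3.
have nbb : b != b' by apply: contraTneq ebb => ->; rewrite e_irr.
have [u [w [tuw du cub cwb]]] := tree_branch_between T lb lb' nbb l3.
have [T' dT'] := tree_exchange T tuw ebb cub cwb.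
eexists; first exact: T'.
have sub : [set x | leaf (add_edge (del_edge t u w) b b') x] \subset
   w |: ([set x | leaf t x] :\ b :\ b').
  apply/subsetP=> x; rewrite !inE /leaf => lx; have := dT' x.
  move: lb lb'; rewrite /leaf; move/eqP: lx => -> /eqP lb /eqP lb'.
  case: (eqVneq x w) => //= xw.
  case: (eqVneq x u) => [->|xu] /=; first by move: du; lia.
  case: (eqVneq x b) => [->|xb] /=; first by rewrite lb.
  case: (eqVneq x b') => [->|xb'] /=; first by rewrite lb'.
  by rewrite !addn0 => <-.
rewrite /lam in l3 *; apply: leq_ltn_trans (subset_leq_card sub) _.
rewrite cardsU1; have := cardsD1 b' ([set x | leaf t x] :\ b).
have := cardsD1 b [set x | leaf t x]; rewrite !inE lb lb'.
by rewrite eq_sym nbb /=; lia.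
Qed.

(* Trade the edge xu for xb. *)
Lemma leaf_shift t R b x u : tree_on t R -> leaf t b -> e x b -> t x u -> u != b ->
    connect (del_edge t x u) u b ->
  exists t', [/\ tree_on t' R, lam t' <= lam t & (lam t' < lam t) ||
                 (deg t u == 2) && leaf t' u].
Proof.
move=> T lb exb txu ub cub.
have [T' dT'] := tree_exchange T txu exb (connect0 _ x) cub.
have nxu : x != u by apply: contraTneq txu => ->; rewrite (tree_irr T).
have nxb : x != b by apply: contraTneq exb => ->; rewrite e_irr.
set t' := add_edge _ _ _ in T' dT'; exists t'.
have du : 1 < deg t u.
  rewrite ltn_neqAle eq_sym; apply/andP; split; last first.
    by apply/card_gt0P; exists x; rewrite inE (tree_sym T).
  apply/negP=> /leaf_nbr[f _ Uf].
  case/connectP: cub => [[|y p] /=]; first by move=> _ E; rewrite E eqxx in ub.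
  case/andP=> /andP[tuy S] _ _; case/negP: S.
  have tux : t u x by rewrite (tree_sym T).
  have -> : y = x by rewrite (Uf _ tuy) (Uf _ tux).
  by rewrite /same_pair !eqxx orbT.
have leafE y : leaf t' y -> (y == u) && (deg t u == 2) || leaf t y && (y != b).
  have nux : (u == x) = false by rewrite eq_sym (negbTE nxu).
  have nbx : (b == x) = false by rewrite eq_sym (negbTE nxb).
  rewrite /leaf => /eqP ly; have := dT' y; rewrite ly; move: lb; rewrite /leaf.
  case: (eqVneq y u) => [->|yu] /=.
    by rewrite nux (negbTE ub) /= addn0 => _ E; rewrite -E.
  case: (eqVneq y b) => [->|yb] /=; first by rewrite nbx => /eqP->.
  by rewrite !orbF andbT => _ /addIn <-.
have sub : [set y | leaf t' y] \subset u |: ([set y | leaf t y] :\ b).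
  by apply/subsetP=> y; rewrite !inE => /leafE/orP[/andP[-> _]|/andP[-> ->]]; rewrite ?orbT.
have := subset_leq_card sub; have := cardsD1 b [set y | leaf t y].
rewrite inE lb cardsU1 !inE -/(lam t) -/(lam t') => E L.
split=> //; first by move: L; case: (~~ _); lia.
case: (boolP (leaf t' u)) => lu.
  case/leafE/orP: (lu) => [/andP[_ ->]|/andP[]]; first by rewrite orbT.
  by rewrite /leaf => /eqP E1; rewrite E1 in du.
apply/orP; left; rewrite E.
have: [set y | leaf t' y] \subset [set y | leaf t y] :\ b.
  apply/subsetP=> y yl; have := subsetP sub y yl; rewrite !inE.
  by case: (eqVneq y u) yl => //= ->; rewrite inE (negbTE lu).
by move/subset_leq_card; rewrite -/(lam t'); lia.
Qed.

End Trees.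

(** [P] is an arbitrary proposition, so the descent on the value of [f] decides by excluded middle
    whether a smaller value occurs. *)
Lemma exists_min (T : Type) (P : T -> Prop) (f : T -> nat) :
  (exists x, P x) -> exists2 x, P x & forall y, P y -> f x <= f y.
Proof.
case=> x0 Px0; have [n] := ubnP (f x0); elim: n x0 Px0 => // n IH x Px fx.
case: (classic (exists2 y, P y & f y < f x)) => [[y Py fy]|nE].
  by apply: (IH y) => //; apply: leq_trans fy _.
by exists x => // y Py; rewrite leqNgt; apply/negP=> fy; apply: nE; exists y.
Qed.

Lemma claw_freeP (V : finType) (e : rel V) v a b c :
    symmetric e -> irreflexive e -> claw_free e ->
    e v a -> e v b -> e v c -> a != b -> a != c -> b != c ->
  [|| e a b, e a c | e b c].
Proof.
move=> es ei cf va vb vc ab ac bc; apply/negPn/negP; rewrite !negb_or.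
case/and3P=> nab nac nbc; apply: cf.
pose s := [:: v; a; b; c]; exists (fun i : 'I_4 => nth v s i).
have nv x : e v x -> v != x by apply: contraTneq => <-; rewrite ei.
split=> [i j /eqP|].
  rewrite nth_uniq //= ?inE; first by move/eqP/val_inj.
  by rewrite !negb_or !nv // ab ac bc.
move=> [[|[|[|[|i]]]] //= ?] [[|[|[|[|j]]]] //= ?];
  rewrite /K13 /= ?ei ?va ?vb ?vc // ?(es _ v) ?va ?vb ?vc //; apply/negbTE => //;
  by rewrite es.
Qed.

(** * Covers of the graph by a tree and hanging paths, and minimal ones *)

Section Decomposition.

Variables (V : finType) (e : rel V) (x0 : V).
Hypotheses (e_sym : symmetric e) (e_irr : irreflexive e) (e_claw : claw_free e).
Implicit Types (t : rel V) (R : {set V}) (P Q : seq V) (ps : seq (seq V)).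

Definition attached R x := [exists r in R, e r x].

Definition hanging R P :=
  [&& P != [::], sorted e P & attached R (head x0 P)].

(** The single permutation condition says that the paths have no repeated vertex, are pairwise
    disjoint, avoid [R] and cover its complement. *)
Record decomposition R t ps : Prop := Decomposition {
  dec_tree : tree_on e t R;
  dec_hang : all (hanging R) ps;
  dec_cover : perm_eq (flatten ps) (enum (~: R)) }.

Definition loose R ps := count (fun P => ~~ attached R (last x0 P)) ps.

(** Lexicographic minimality in four levels, each field comparing only with decompositions that tie
    on the previous levels. *)
Record minimal R t ps : Prop := Minimal {
  min_dec : decomposition R t ps;
  min_lam : forall R' t' ps', decomposition R' t' ps' -> lam t <= lam t';
  min_card : forall R' t' ps', decomposition R' t' ps' -> lam t' = lam t ->
    #|R| <= #|R'|;
  min_size : forall R' t' ps', decomposition R' t' ps' -> lam t' = lam t ->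
    #|R'| = #|R| -> size ps <= size ps';
  min_loose : forall R' t' ps', decomposition R' t' ps' -> lam t' = lam t ->
    #|R'| = #|R| -> size ps' = size ps -> loose R ps <= loose R' ps' }.

Lemma minimal_exists R0 t0 ps0 : decomposition R0 t0 ps0 ->
  exists R t ps, minimal R t ps.
Proof.
move=> D0.
pose T := ({set V} * rel V * seq (seq V))%type.
pose P1 (s : T) := decomposition s.1.1 s.1.2 s.2.
have [s1 D1 M1] := @exists_min T P1 (fun s => lam s.1.2)
  (ex_intro _ (R0, t0, ps0) D0).
pose P2 (s : T) := P1 s /\ lam s.1.2 = lam s1.1.2.
have [s2 [D2 l2] M2] := @exists_min T P2 (fun s => #|s.1.1|)
  (ex_intro _ s1 (conj D1 erefl)).
pose P3 (s : T) := P2 s /\ #|s.1.1| = #|s2.1.1|.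
have [s3 [[D3 l3] r3] M3] := @exists_min T P3 (fun s => size s.2)
  (ex_intro _ s2 (conj (conj D2 l2) erefl)).
pose P4 (s : T) := P3 s /\ size s.2 = size s3.2.
have [s4 [[[D4 l4] r4] n4] M4] := @exists_min T P4 (fun s => loose s.1.1 s.2)
  (ex_intro _ s3 (conj (conj (conj D3 l3) r3) erefl)).
exists s4.1.1, s4.1.2, s4.2; split=> //.
- by move=> R t ps D; rewrite l4; apply: (M1 (R, t, ps)).
- move=> R t ps D; rewrite l4 r4 => El.
  by apply: (M2 (R, t, ps)); split.
- move=> R t ps D; rewrite l4 r4 n4 => El Er.
  by apply: (M3 (R, t, ps)); split.
- move=> R t ps D; rewrite l4 r4 n4 => El Er En.
  by apply: (M4 (R, t, ps)).
Qed.

(** Lets facts about the leaves of [t] be applied to the leaves of another tree on [R] with no more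
    leaves. *)
Lemma minimal_tree R t ps t' : minimal R t ps -> tree_on e t' R -> lam t' <= lam t ->
  minimal R t' ps.
Proof.
move=> M T' l'; have [D Ml Mr Mn Mc] := M.
have D' : decomposition R t' ps by case: D => _ H C; split.
have E : lam t' = lam t by apply/eqP; rewrite eqn_leq l' (Ml _ _ _ D').
by split=> //; rewrite E.
Qed.

Lemma attached_sub R R' x : R \subset R' -> attached R x -> attached R' x.
Proof.
by move/subsetP=> s /exists_inP[r rR er]; apply/exists_inP; exists r => //; apply: s.
Qed.

Lemma sorted_glue P Q : P != [::] -> Q != [::] ->
  sorted e (P ++ Q) = [&& sorted e P, e (last x0 P) (head x0 Q) & sorted e Q].
Proof. by case: P => // a P _; case: Q => // b Q _; rewrite /= cat_path. Qed.

Lemma sorted_reverse P : sorted e (rev P) = sorted e P.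
Proof. by rewrite rev_sorted; apply: eq_sorted => a b; apply: e_sym. Qed.

Lemma head_rev P : head x0 (rev P) = last x0 P.
Proof. by case: (lastP P) => // Q z; rewrite rev_rcons last_rcons. Qed.

Lemma last_rev P : last x0 (rev P) = head x0 P.
Proof. by case: P => // z Q; rewrite rev_cons last_rcons. Qed.

Lemma rev_nil P : (rev P == [::]) = (P == [::]).
Proof. by rewrite -!size_eq0 size_rev. Qed.

Lemma head_glue P Q : P != [::] -> head x0 (P ++ Q) = head x0 P.
Proof. by case: P. Qed.

Lemma last_glue P Q : Q != [::] -> last x0 (P ++ Q) = last x0 Q.
Proof. by case: Q => // a Q _; rewrite last_cat. Qed.

Lemma head_mem P : P != [::] -> head x0 P \in P.
Proof. by case: P => // a P _; rewrite inE eqxx. Qed.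

Lemma last_mem P : P != [::] -> last x0 P \in P.
Proof. by case: P => // a P _; rewrite /= mem_last. Qed.

Section Minimal.

Variables (R : {set V}) (t : rel V) (ps : seq (seq V)).
Hypothesis (M : minimal R t ps).

Let D := min_dec M.
Let T := dec_tree D.

(** The local move behind the later contradictions: the vertices of a few paths [qs] are rearranged
    into other hanging paths, while [R], [t] and the remaining paths are kept. *)
Lemma dec_replace qs qs' rest : perm_eq ps (qs ++ rest) ->
    all (hanging R) qs' -> perm_eq (flatten qs') (flatten qs) ->
  decomposition R t (qs' ++ rest).
Proof.
move=> pE H pF; have := dec_hang D; rewrite (perm_all _ pE) all_cat => /andP[_ Hr].
split; rewrite ?all_cat ?H //; apply: perm_trans (dec_cover D).
by rewrite perm_sym (permPl (perm_flatten pE)) !flatten_cat perm_cat2r perm_sym.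
Qed.

Lemma size_replace qs qs' rest : perm_eq ps (qs ++ rest) ->
    all (hanging R) qs' -> perm_eq (flatten qs') (flatten qs) ->
  size qs <= size qs'.
Proof.
move=> pE H pF; have := min_size M (dec_replace pE H pF) erefl erefl.
by rewrite (perm_size pE) !size_cat leq_add2r.
Qed.

Lemma loose_replace qs qs' rest : perm_eq ps (qs ++ rest) ->
    all (hanging R) qs' -> perm_eq (flatten qs') (flatten qs) ->
    size qs' = size qs -> loose R qs <= loose R qs'.
Proof.
move=> pE H pF nE; have := min_loose M (dec_replace pE H pF) erefl erefl.
rewrite (perm_size pE) !size_cat nE => /(_ erefl).
by rewrite /loose (permP pE) !count_cat leq_add2r.
Qed.

Lemma hanging_in P : P \in ps -> hanging R P.
Proof. by apply/allP: P; apply: dec_hang D. Qed.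

Lemma cover_uniq : uniq (flatten ps).
Proof. by rewrite (perm_uniq (dec_cover D)) enum_uniq. Qed.

Lemma cover_mem x : (x \in flatten ps) = (x \notin R).
Proof. by rewrite (perm_mem (dec_cover D)) mem_enum inE. Qed.

Lemma path_notin P x : P \in ps -> x \in P -> x \notin R.
Proof. by move=> Pp xP; rewrite -cover_mem; apply/flattenP; exists P. Qed.

Lemma pick1 P : P \in ps -> perm_eq ps ([:: P] ++ rem P ps).
Proof. exact: perm_to_rem. Qed.

Lemma pick2 P Q : P \in ps -> Q \in ps -> P != Q ->
  exists rest, perm_eq ps ([:: P; Q] ++ rest).
Proof.
move=> Pp Qp PQ; exists (rem Q (rem P ps)).
rewrite (permPl (perm_to_rem Pp)) /= perm_cons; apply: perm_to_rem.
by move: Qp; rewrite (perm_mem (perm_to_rem Pp)) inE eq_sym (negbTE PQ).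
Qed.

Lemma pick3 P P' Q : P \in ps -> P' \in ps -> Q \in ps ->
    P != P' -> P != Q -> P' != Q ->
  exists rest, perm_eq ps ([:: P; P'; Q] ++ rest).
Proof.
move=> Pp P'p Qp PP PQ PQ'; have [r pE] := pick2 Pp P'p PP.
exists (rem Q r); rewrite (permPl pE) /= !perm_cons; apply: perm_to_rem.
move: Qp; rewrite (perm_mem pE) !inE.
by rewrite ![Q == _]eq_sym (negbTE PQ) (negbTE PQ').
Qed.

Lemma disjoint_paths P Q x : P \in ps -> Q \in ps -> x \in P -> x \in Q -> P = Q.
Proof.
move=> Pp Qp xP xQ; apply/eqP/negPn/negP=> PQ.
have [r pE] := pick2 Pp Qp PQ.
have := cover_uniq; rewrite (perm_uniq (perm_flatten pE)) /= catA !cat_uniq.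
by case/and3P=> /and3P[_ /hasP[]]; exists x.
Qed.

(** Gluing [P] to [Q], reversed if the two last vertices are adjacent, would give fewer paths. *)
Lemma ends_nonadjacent P Q : P \in ps -> Q \in ps -> P != Q ->
  ~~ e (last x0 P) (last x0 Q) && ~~ e (last x0 P) (head x0 Q).
Proof.
move=> Pp Qp PQ; have [r pE] := pick2 Pp Qp PQ.
have /and3P[P0 Ps Pa] := hanging_in Pp; have /and3P[Q0 Qs Qa] := hanging_in Qp.
have no_glue Q' : perm_eq Q' Q -> Q' != [::] -> sorted e Q' ->
    e (last x0 P) (head x0 Q') -> False.
  move=> Qpe Q'0 Q's ee; have := @size_replace _ [:: P ++ Q'] _ pE.
  rewrite /= cats0 /hanging andbT sorted_glue // Ps ee Q's head_glue // Pa.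
  rewrite -size_eq0 size_cat addn_eq0 size_eq0 (negbTE P0) cats0.
  by rewrite perm_cat2l => /(_ isT Qpe).
apply/andP; split; apply/negP=> ee.
  apply: (no_glue (rev Q)); rewrite ?perm_rev ?rev_nil ?sorted_reverse ?head_rev //.
exact: no_glue ee.
Qed.

Definition private b P :=
  ~~ attached (R :\ b) (head x0 P) && ~~ attached (R :\ b) (last x0 P).

Lemma private_head b P r : P \in ps -> private b P -> r \in R ->
  e r (head x0 P) -> r = b.
Proof.
move=> Pp /andP[pr _] rR er; apply/eqP/negPn/negP=> rb.
by case/exists_inP: pr; exists r => //; rewrite !inE rb.
Qed.

Lemma private_headE b P : P \in ps -> private b P -> e b (head x0 P).
Proof.
move=> Pp pr; have /and3P[_ _ /exists_inP[r rR er]] := hanging_in Pp.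
by rewrite -(private_head Pp pr rR er).
Qed.

(* Otherwise b could be moved from the tree onto a hanging path. *)
Lemma two_private b : leaf t b -> exists P1 P2,
  [/\ P1 \in ps, P2 \in ps, P1 != P2, private b P1 & private b P2].
Proof.
move=> lb; have [f tbf _] := leaf_nbr lb.
have bR := leaf_dom T lb; have fR := tree_domr T tbf.
have fb : f != b by apply: contraTneq tbf => ->; rewrite (tree_irr e_irr T).
have uF : uniq (filter (private b) ps).
  apply: filter_uniq; have := cover_uniq; have := dec_hang D.
  elim: ps => //= P qs IH /andP[/and3P[P0 _ _] H]; rewrite cat_uniq.
  case/and3P=> _ nh /(IH H) ->; rewrite andbT; apply: contra nh => Pq.
  apply/hasP; exists (head x0 P); last exact: head_mem.
  by apply/flattenP; exists P => //; apply: head_mem.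
set F := filter _ _ in uF; case: (ltnP 1 (size F)) => FS.
  have in1 P : P \in F -> (P \in ps) && private b P by rewrite mem_filter andbC.
  case: F FS uF in1 => [|P1 [|P2 qs]] //= _ uF in1.
  have /andP[P1p pr1] := in1 P1 (mem_head _ _).
  have /andP[P2p pr2] : (P2 \in ps) && private b P2.
    by apply: in1; rewrite !inE eqxx orbT.
  exists P1, P2; split=> //.
  by move: uF; rewrite /= inE negb_or -andbA => /and3P[].
exfalso; set c := del_edge t b f.
have T' : tree_on e c (R :\ b) := tree_del_leaf e_irr T lb tbf.
have l' : lam c <= lam t := lam_del_leaf e_irr T lb tbf.
(* A path that is not private has an end attached to [R :\ b]; it is reversed unless its head is
   such an end. *)
pose turn P := if attached (R :\ b) (head x0 P) then P else rev P.
pose G := filter (predC (private b)) ps.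
(* [F] has at most one path, so [b :: flatten F] is a single path, hung on [f]; the new tree has no
   more leaves and one vertex fewer. *)
suff D' : decomposition (R :\ b) c ((b :: flatten F) :: map turn G).
  have E : lam c = lam t by apply/eqP; rewrite eqn_leq l' (min_lam M D').
  have := min_card M D' E; rewrite (cardsD1 b R) bR; lia.
split=> //=.
- apply/andP; split; last first.
    apply/allP=> _ /mapP[P PG ->]; move: PG; rewrite mem_filter /= negb_and !negbK.
    case/andP=> Ha Pp; have /and3P[P0 Ps _] := hanging_in Pp.
    rewrite /hanging /turn; case: ifP Ha => [-> _|_ /= Ha]; first by rewrite P0 Ps.
    by rewrite rev_nil P0 sorted_reverse Ps head_rev.
  have ab : attached (R :\ b) b.
    apply/exists_inP; exists f; first by rewrite !inE fb.
    by apply: (tree_sub T); rewrite (tree_sym T).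
  rewrite /hanging /= ab andbT.
  have inF P : P \in F -> (P \in ps) && private b P by rewrite mem_filter andbC.
  case: F FS inF {uF} => [|P [|]] //= _ /(_ _ (mem_head _ _))/andP[Pp pr].
  rewrite cats0; have /and3P[P0 Ps _] := hanging_in Pp.
  by have := private_headE Pp pr; case: P P0 Ps {Pp pr} => //= z P _ -> ->.
have fE : perm_eq (flatten (map turn G)) (flatten G).
  elim: (G) => //= P qs IH; apply: perm_cat => //.
  by rewrite /turn; case: ifP => // _; rewrite perm_rev.
apply: (@perm_trans _ (b :: flatten ps)).
  rewrite perm_cons (perm_catl _ fE) -flatten_cat.
  by apply: perm_flatten; rewrite perm_filterC.
apply: uniq_perm; rewrite ?enum_uniq //=.
  by rewrite cover_mem bR cover_uniq.
by move=> x; rewrite inE cover_mem mem_enum !inE negb_and negbK.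
Qed.

Lemma leaf_edge b : leaf t b -> exists2 f, f \in R & e b f.
Proof.
by case/leaf_nbr=> f tbf _; exists f; [apply: tree_domr T tbf | apply: tree_sub T _ _ tbf].
Qed.

Lemma path_neq P x r : P \in ps -> x \in P -> r \in R -> x != r.
Proof. by move=> Pp xP rR; apply: contraTneq rR => <-; apply: path_notin xP. Qed.

(** A neighbor of the last vertex in [R] could only be [b]. Then [b] would be the centre of a claw
    with this last vertex, the head of another private path [P'] and a tree neighbor [f]; each edge
    that could prevent the claw is excluded. *)
Lemma private_last b P r : leaf t b -> P \in ps -> private b P -> r \in R ->
  ~~ e r (last x0 P).
Proof.
move=> lb Pp pr rR; apply/negP=> erl.
have rb : r = b.
  apply/eqP/negPn/negP=> rb; case/andP: pr => _ /exists_inP[].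
  by exists r => //; rewrite !inE rb.
have [P' [P'p PP' pr']] : exists P', [/\ P' \in ps, P != P' & private b P'].
  have [P1 [P2 [P1p P2p P12 pr1 pr2]]] := two_private lb.
  case: (eqVneq P P1) => [->|PP1]; [by exists P2 | by exists P1].
have [f fR ebf] := leaf_edge lb; rewrite rb in erl.
have /and3P[P0 _ _] := hanging_in Pp; have /and3P[P'0 _ _] := hanging_in P'p.
have nlh : last x0 P != head x0 P'.
  apply: contraNneq PP' => E; apply/eqP; apply: (disjoint_paths Pp P'p (last_mem P0)).
  by rewrite E head_mem.
have ff := private_head P'p pr' fR.
have := claw_freeP e_sym e_irr e_claw erl (private_headE P'p pr') ebf nlh
  (path_neq Pp (last_mem P0) fR) (path_neq P'p (head_mem P'0) fR).
have fb : f != b by apply: contraTneq ebf => ->; rewrite e_irr.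
case/or3P.
- by apply/negP; case/andP: (ends_nonadjacent Pp P'p PP').
- move=> elf; case/andP: pr => _ /exists_inP[]; exists f; first by rewrite !inE fb.
  by rewrite e_sym.
- by rewrite e_sym => /ff E; rewrite E eqxx in fb.
Qed.

(** The head of a private path has no neighbor in [R] but [b], so two nonadjacent neighbors of [b]
    in [R] would form a claw with it. *)
Lemma leaf_simplicial b r r' : leaf t b -> r \in R -> r' \in R ->
  e b r -> e b r' -> r != r' -> e r r'.
Proof.
move=> lb rR r'R ebr ebr' rr'.
have [P [_ [Pp _ _ pr _]]] := two_private lb.
have /and3P[P0 _ _] := hanging_in Pp.
have nb x : e b x -> x != b by apply: contraTneq => ->; rewrite e_irr.
have hP := head_mem P0.
have := claw_freeP e_sym e_irr e_claw (private_headE Pp pr) ebr ebr'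
  (path_neq Pp hP rR) (path_neq Pp hP r'R) rr'.
case/or3P=> //; rewrite e_sym => /(private_head Pp pr) H.
- by have := nb _ ebr; rewrite H ?eqxx.
- by have := nb _ ebr'; rewrite H ?eqxx.
Qed.

End Minimal.
End Decomposition.

(** * Leaves of the tree in a minimal cover with at least three leaves *)

Section ManyLeaves.

Variables (V : finType) (e : rel V) (x0 : V).
Hypotheses (e_sym : symmetric e) (e_irr : irreflexive e) (e_claw : claw_free e).
Variables (R : {set V}) (t : rel V) (ps : seq (seq V)).
Hypothesis (M : minimal e x0 R t ps).
Hypothesis (many : 2 < lam t).

Let D := min_dec M.
Let T := dec_tree D.

Lemma leaves_nonadjacent b b' : leaf t b -> leaf t b' -> ~~ e b b'.
Proof.
move=> lb lb'; apply/negP=> ebb.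
have [t' T' l'] := leaf_join e_sym e_irr T lb lb' ebb many.
have D' : decomposition e x0 R t' ps by case: D => _ H C; split.
by have := min_lam M D'; rewrite leqNgt l'.
Qed.

(** Otherwise hang [y] on [b]: it replaces [b] as a leaf and is adjacent to the leaf [b'], so
    joining the two lowers the number of leaves. *)
Lemma leaves_share_no_outer b b' y : leaf t b -> leaf t b' -> b != b' ->
  e b y -> e b' y -> y \in R.
Proof.
move=> lb lb' bb eby eb'y; apply/negPn/negP=> yR.
have [T1 d1] := tree_pendant e_sym e_irr T (leaf_dom T lb) yR eby.
have [ly l1] := lam_pendant e_sym e_irr T lb yR eby.
set t1 := add_edge t b y in T1 d1 ly l1.
have lb1 : leaf t1 b'.
  have nbb' : (b' == b) = false by rewrite eq_sym (negbTE bb).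
  have nb'y : (b' == y) = false.
    by apply/negbTE; apply: contraNneq yR => <-; apply: leaf_dom T lb'.
  by rewrite /leaf d1 nbb' nb'y addn0.
have [||t' T' l'] := leaf_join e_sym e_irr T1 ly lb1; rewrite ?l1 // 1?e_sym //.
have [Q Qp yQ] : exists2 Q, Q \in ps & y \in Q.
  by apply/flattenP; rewrite (cover_mem M).
have pE := pick1 Qp; case/splitPr: yQ Qp pE => Q1 Q2 Qp pE.
have /and3P[_ Qs Qa] := hanging_in M Qp.
have sub : R \subset y |: R by apply: subsetUr.
(* Removing [y] splits its path; nonempty pieces stay hanging, the first by its old head and the
   second on [y] itself. *)
pose qs := filter (fun P => P != [::]) [:: Q1; Q2].
have D' : decomposition e x0 (y |: R) t' (qs ++ rem (Q1 ++ y :: Q2) ps).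
  split=> //.
  - rewrite all_cat; apply/andP; split; last first.
      apply/allP=> P /mem_rem /(hanging_in M)/and3P[P0 Ps Pa].
      by rewrite /hanging P0 Ps (attached_sub sub Pa).
    have H1 : Q1 != [::] -> hanging e x0 (y |: R) Q1.
      move=> Q10; rewrite /hanging Q10 (cat_sorted2 Qs).1 /=.
      by move: Qa; rewrite head_glue // => /(attached_sub sub).
    have H2 : Q2 != [::] -> hanging e x0 (y |: R) Q2.
      move=> Q20; have := (cat_sorted2 Qs).2; case: (Q2) Q20 => //= z Q' _.
      case/andP=> eyz Q's; rewrite /hanging /= Q's /=.
      by apply/exists_inP; exists y; rewrite ?setU11.
    rewrite /qs /=; case: ifP => [/H1 h1|_]; case: ifP => [/H2 h2|_] //=;
    by rewrite ?h1 ?h2.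
  - rewrite flatten_cat.
    have -> : flatten qs = Q1 ++ Q2.
      rewrite /qs /=; case: (Q1) => [|? ?]; case: (Q2) => [|? ?]; by rewrite /= ?cats0.
    have C := dec_cover D; rewrite (permPl (perm_flatten pE)) in C.
    have E : perm_eq (enum (~: R)) (y :: enum (~: (y |: R))).
      apply: uniq_perm; rewrite /= ?enum_uniq ?mem_enum ?inE ?eqxx //.
      move=> x; rewrite !(inE, mem_enum) negb_or.
      by case: (eqVneq x y) => [->|_] //=.
    rewrite -(perm_cons y); apply: perm_trans (perm_trans C E).
    by rewrite /= -!catA -cat1s perm_catCA.
by have := min_lam M D'; rewrite leqNgt -l1 l'.
Qed.

(** Trading [x u] for [x b] cannot reduce the number of leaves, hence [u] becomes a leaf of another
    minimal tree, and the neighbors in [R] of such a leaf form a clique. *)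
Lemma shift_nbr b x u : leaf t b -> e x b -> t x u -> u != b ->
    connect (del_edge t x u) u b ->
  deg t u = 2 /\ {in R &, forall r r', e u r -> e u r' -> r != r' -> e r r'}.
Proof.
move=> lb exb txu ub cub.
have [t' [T' l' H]] := leaf_shift e_sym e_irr T lb exb txu ub cub.
have M' := minimal_tree M T' l'.
case/orP: H => [lt|/andP[/eqP du lu]].
  have D' : decomposition e x0 R t' ps by case: D => _ H C; split.
  by have := min_lam M D'; rewrite leqNgt lt.
by split=> // r r' rR r'R; apply: (leaf_simplicial e_sym e_irr e_claw M') lu _ _.
Qed.

(** Walking away from [x], [shift_nbr] gives each vertex [y] other than [b] degree two and makes the
    next vertex equal or adjacent to [b]. So the walk cannot end in a leaf other than [b]. *)
Lemma chain_end b x y p : leaf t b -> e x b -> (y == b) || e y b -> t x y ->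
    connect (del_edge t x y) y b -> path t y p -> uniq [:: x, y & p] ->
    leaf t (last y p) -> last y p = b.
Proof.
move=> lb; elim: p x y => [|z p IH] x y exb yb txy cyb.
  move=> _ _ /= ly; apply/eqP/negPn/negP=> nyb.
  have [dy _] := shift_nbr lb exb txy nyb cyb.
  by move: ly; rewrite /leaf dy.
move=> /= /andP[tyz pz] /and3P[nx ny up] ll.
have tyx : t y x by rewrite (tree_sym T).
have nxz : x != z by apply: contraNneq nx => ->; rewrite !inE eqxx orbT.
case: (eqVneq y b) yb => [yE|nyb] /= eyb.
  have [f _ Uf] := leaf_nbr lb; rewrite yE in tyz tyx.
  by rewrite (Uf _ tyz) (Uf _ tyx) eqxx in nxz.
have [dy sy] := shift_nbr lb exb txy nyb cyb.
have bR := leaf_dom T lb; have zR := tree_domr T tyz.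
have nbr w : t y w -> w = x \/ w = z.
  move=> tyw; have sub : [set x; z] \subset [set w | t y w].
    by apply/subsetP=> v; rewrite !inE => /orP[]/eqP->.
  have : w \in [set x; z].
    suff -> : [set x; z] = [set w | t y w] by rewrite inE.
    apply/eqP; rewrite eqEcard sub cards2 nxz /=.
    by rewrite -/(deg t y) dy.
  by rewrite !inE => /orP[]/eqP; [left | right].
apply: (IH y z) => //.
- case: (eqVneq z b) => //= zb; apply: sy => //.
  by apply: (tree_sub T).
- case/connectP: cyb => q0 pq0 Eq0; case/shortenP: pq0 Eq0 => [[|w q]] /=.
    by move=> _ _ _ E; rewrite E eqxx in nyb.
  case/andP=> /andP[tyw nS] pq /and3P[nyq uq _] _ Eb.
  have wz : w = z.
    case: (nbr _ tyw) => // wx; case/negP: nS.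
    by rewrite wx /same_pair !eqxx orbT.
  rewrite wz in pq Eb nyq; apply/connectP; exists q => //.
  apply: path_del_edge; last by rewrite nyq.
  by apply: sub_path pq => u v /andP[].
- by rewrite /= ny.
Qed.

(** If [z] is adjacent to both leaves, take the path from [z] to a third leaf [x], with first step
    [y]. Claw-freeness at [z] makes [y] equal or adjacent to [b] or [b'], and [chain_end] then
    forces [x] to be that leaf. *)
Lemma leaf_balls_disjoint b b' z : leaf t b -> leaf t b' -> b != b' -> z \in R ->
  ~~ (((z == b) || e z b) && ((z == b') || e z b')).
Proof.
move=> lb lb' bb zR; apply/negP=> /andP[zb zb'].
have nbb := leaves_nonadjacent lb lb'.
have {}zb : e z b.
  case/orP: zb => // /eqP zE; move: zb'.
  by rewrite zE (negbTE bb) (negbTE nbb).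
have {}zb' : e z b'.
  case/orP: zb' => // /eqP zE; move: zb.
  by rewrite zE e_sym (negbTE nbb).
have bR := leaf_dom T lb; have b'R := leaf_dom T lb'.
have [x] : exists x, x \in [set x | leaf t x] :\ b :\ b'.
  apply/card_gt0P; have := cardsD1 b' ([set x | leaf t x] :\ b).
  have := cardsD1 b [set x | leaf t x]; rewrite !inE lb lb'.
  by move: many; rewrite /lam; move: (eq_sym b b'); case: (b' == b); lia.
rewrite !inE => /and3P[xb' xb lx].
have [p0 pp0 Ep0] := connectP (tree_conn T zR (leaf_dom T lx)).
case/shortenP: pp0 Ep0 => [[|y p]] pp up _ Ep {p0}.
  rewrite /= in Ep; rewrite Ep in lx.
  have := leaf_simplicial e_sym e_irr e_claw M lx bR b'R zb zb' bb.
  by rewrite (negbTE nbb).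
move: pp => /= /andP[tzy py].
have ezy := tree_sub T tzy; have yR := tree_domr T tzy.
have tyz : t y z by rewrite (tree_sym T).
(* Deleting [z y] leaves [c] on the side of [y]: otherwise, by [shift_nbr], exchanging [y z] for
   [y c] would force the neighbors [b] and [b'] of [z] to be adjacent. *)
have zz c : leaf t c -> e z c -> e y c -> connect (del_edge t z y) y c.
  move=> lc ezc eyc; have cR := leaf_dom T lc.
  have csc := sym_connect_sym (del_edge_sym z y (tree_sym T)).
  have := del_edge_connect T tzy (tree_conn T cR cR); rewrite connect0 => _.
  have := del_edge_connect T tzy (tree_conn T cR zR).
  rewrite orbA orbb; case/orP=> [cz|]; last by rewrite csc.
  have nzc : z != c by apply: contraTneq ezc => ->; rewrite e_irr.
  have ccz : connect (del_edge t y z) z c.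
    by rewrite (eq_connect (del_edgeC t y z)) csc.
  have [_ s] := shift_nbr lc eyc tyz nzc ccz.
  by have := s b b' bR b'R zb zb' bb; rewrite (negbTE nbb).
have fin c : leaf t c -> e z c -> (y == c) || e y c -> x = c.
  move=> lc ezc yc; rewrite Ep /=; apply: (chain_end lc ezc yc tzy) => //.
    case/orP: yc => [/eqP->|]; [exact: connect0 | exact: zz].
  by rewrite /= in Ep; rewrite -Ep.
case: (eqVneq y b) => [yb|nyb].
  by rewrite (fin b) ?yb ?eqxx // in xb.
case: (eqVneq y b') => [yb'|nyb'].
  by rewrite (fin b') ?yb' ?eqxx // in xb'.
have := claw_freeP e_sym e_irr e_claw zb zb' ezy bb.
rewrite eq_sym nyb eq_sym nyb' (negbTE nbb) /= => /(_ isT isT).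
case/orP; rewrite e_sym => ey.
  by rewrite (fin b) ?ey ?orbT ?eqxx // in xb.
by rewrite (fin b') ?ey ?orbT ?eqxx // in xb'.
Qed.

End ManyLeaves.

(** * Adjacencies between hanging paths in a minimal cover *)

Ltac perm_count :=
  apply/permP=> ?; rewrite /= ?cats0 -?cats1;
  rewrite ?(count_cat, count_rev, count_cat, count_rev) /=; clear; lia.

Section DegreeSum.

Variables (V : finType) (e : rel V) (x0 : V).
Hypotheses (e_sym : symmetric e) (e_irr : irreflexive e) (e_claw : claw_free e).
Variables (R : {set V}) (t : rel V) (ps : seq (seq V)).
Hypothesis (M : minimal e x0 R t ps).
Hypothesis (many : 2 < lam t).

Let D := min_dec M.
Let T := dec_tree D.
Let hang := hanging_in M.

(** Otherwise [P] could take over [q :: Q2] and leave [Q1], whose end is attached; the number of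
    paths is unchanged and the loose end of [P] disappears. *)
Lemma no_outer_neighbor_before P Q1 q Q2 : P \in ps -> Q1 ++ q :: Q2 \in ps ->
    P != Q1 ++ q :: Q2 -> ~~ attached e R (last x0 P) -> Q1 != [::] ->
  e (last x0 P) q -> ~~ attached e R (last x0 Q1).
Proof.
move=> Pp Qp PQ Pl Q10 eq; apply/negP=> Qa.
have [r pE] := pick2 Pp Qp PQ.
have /and3P[P0 Ps Pa] := hang Pp; have /and3P[_ Qs Qh] := hang Qp.
have [Q1s Q2s] := (cat_sorted2 Qs).
have H : all (hanging e x0 R) [:: P ++ q :: Q2; Q1].
  rewrite /= /hanging andbT Q10 Q1s (sorted_glue e x0) // Ps eq Q2s !head_glue // Pa.
  by move: Qh; rewrite head_glue // => ->; case: (P) P0.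
have := loose_replace M pE H _ erefl.
rewrite /loose /= !last_glue // Pl Qa /= addn0 !cats0.
rewrite -[perm_eq _ _]/(perm_eq ((P ++ q :: Q2) ++ Q1) (P ++ Q1 ++ q :: Q2)).
by rewrite -catA perm_cat2l perm_catC => /(_ (perm_refl _)); case: attached.
Qed.

(** Otherwise [P] could continue through [q] and [Q1] backwards, ending at the attached head, while
    [Q2] hangs by its own head: again one loose path fewer. *)
Lemma no_outer_neighbor_after P Q1 q Q2 : P \in ps -> Q1 ++ q :: Q2 \in ps ->
    P != Q1 ++ q :: Q2 -> ~~ attached e R (last x0 P) -> Q2 != [::] ->
  e (last x0 P) q -> ~~ attached e R (head x0 Q2).
Proof.
move=> Pp Qp PQ Pl Q20 eq; apply/negP=> Qa.
have [r pE] := pick2 Pp Qp PQ.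
have /and3P[P0 Ps Pa] := hang Pp; have /and3P[_ Qs Qh] := hang Qp.
have := Qs; rewrite -cat_rcons => /cat_sorted2[Q1s Q2s].
have q0 : rev (rcons Q1 q) != [::] by rewrite rev_rcons.
have H : all (hanging e x0 R) [:: P ++ rev (rcons Q1 q); Q2].
  rewrite /= /hanging andbT Q20 Q2s Qa (sorted_glue e x0) // Ps sorted_reverse // Q1s.
  by rewrite rev_rcons /= eq head_glue // Pa !andbT; case: (P) P0.
have := loose_replace M pE H _ erefl.
rewrite /loose /= !last_glue // last_rev.
have -> : head x0 (rcons Q1 q) = head x0 (Q1 ++ q :: Q2) by case: (Q1).
rewrite Qh Pl /= !cats0 /=.
have -> : last q Q2 = last x0 Q2 by case: (Q2) Q20.
move=> /(_ _); have -> : perm_eq ((P ++ rev (rcons Q1 q)) ++ Q2) (P ++ Q1 ++ q :: Q2).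
  by perm_count.
by move=> /(_ isT); case: attached.
Qed.

(** If [q] ends its path, [ends_nonadjacent] applies. Otherwise use claw-freeness at [q] for [b],
    the end of [P] and the successor [q2]: each of the three possible edges contradicts looseness or
    one of the two preceding lemmas. *)
Lemma free_end_and_tree_vertex P Q1 q Q2 b : P \in ps -> Q1 ++ q :: Q2 \in ps ->
    P != Q1 ++ q :: Q2 -> ~~ attached e R (last x0 P) -> b \in R ->
  e (last x0 P) q -> ~~ e b q.
Proof.
move=> Pp Qp PQ Pl bR ePq; apply/negP=> ebq.
have /and3P[P0 _ _] := hang Pp.
case: Q2 Qp PQ => [|q2 Q2] Qp PQ.
  have := ends_nonadjacent e_sym M Pp Qp PQ.
  by rewrite last_cat /= ePq.
have /and3P[_ Qs _] := hang Qp.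
have eqq2 : e q q2.
  by move: Qs; rewrite sorted_cat_cons /= => /and3P[].
have q2Q : q2 \in Q1 ++ [:: q, q2 & Q2] by rewrite mem_cat !inE eqxx !orbT.
have := claw_freeP e_sym e_irr e_claw (v := q) (a := b) (b := last x0 P) (c := q2).
rewrite ![e q _]e_sym ebq ePq -e_sym eqq2.
have nbP : b != last x0 P by rewrite eq_sym (path_neq M Pp (last_mem x0 P0) bR).
have nbq2 : b != q2 by rewrite eq_sym (path_neq M Qp q2Q bR).
have nPq2 : last x0 P != q2.
  apply: contraNneq PQ => E; apply/eqP/(disjoint_paths M Pp Qp (last_mem x0 P0)).
  by rewrite E.
move=> /(_ isT isT isT nbP nbq2 nPq2) /or3P[] E.
- by case/negP: Pl; apply/exists_inP; exists b.
- have := no_outer_neighbor_after Pp Qp PQ Pl isT ePq.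
  by case/negP; apply/exists_inP; exists b.
(* The splitting point is shifted by one: the initial part now ends with [q], which is attached
   through [b]. *)
- have q0 : rcons Q1 q != [::] by case: (Q1).
  have := @no_outer_neighbor_before P (rcons Q1 q) q2 Q2 Pp.
  rewrite cat_rcons last_rcons => /(_ Qp PQ Pl q0 E)/negP[].
  by apply/exists_inP; exists b.
Qed.

(** Claw-freeness at [q] for the two free ends and the successor [q2]: adjacent ends can be merged,
    and an edge from an end to [q2] allows three paths to be rearranged into two. *)
Lemma two_free_ends P P' Q1 q Q2 : P \in ps -> P' \in ps -> Q1 ++ q :: Q2 \in ps ->
    P != P' -> P != Q1 ++ q :: Q2 -> P' != Q1 ++ q :: Q2 ->
  e (last x0 P) q -> ~~ e (last x0 P') q.
Proof.
move=> Pp P'p Qp PP PQ P'Q eP; apply/negP=> eP'.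
have /and3P[P0 Ps Pa] := hang Pp; have /and3P[P'0 P's P'a] := hang P'p.
have /and3P[_ Qs Qh] := hang Qp.
case: Q2 Qp PQ P'Q Qs Qh => [|q2 Q2] Qp PQ P'Q Qs Qh.
  have := ends_nonadjacent e_sym M Pp Qp PQ.
  by rewrite last_cat /= eP.
have eqq2 : e q q2.
  by move: Qs; rewrite sorted_cat_cons /= => /and3P[].
have := Qs; rewrite -cat_rcons => /cat_sorted2[Q1s Q2s].
have q2Q : q2 \in Q1 ++ [:: q, q2 & Q2] by rewrite mem_cat !inE eqxx !orbT.
have absurd A B : A \in ps -> B \in ps -> A != B -> A != Q1 ++ [:: q, q2 & Q2] ->
    B != Q1 ++ [:: q, q2 & Q2] -> e (last x0 B) q -> e (last x0 A) q2 -> False.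
  move=> Ap Bp AB AQ BQ eB eA; have [r pE] := pick3 Ap Bp Qp AB AQ BQ.
  have /and3P[A0 As Aa] := hang Ap; have /and3P[B0 Bs Ba] := hang Bp.
  have q0 : rcons Q1 q != [::] by case: (Q1).
  have rB : rev B != [::] by rewrite rev_nil.
  have := @size_replace _ _ _ _ _ _ M _ [:: A ++ q2 :: Q2; rcons Q1 q ++ rev B] _ pE.
  rewrite /= /hanging !(sorted_glue e x0) // As eA Q2s Q1s last_rcons sorted_reverse // Bs.
  rewrite head_rev e_sym eB !head_glue // Aa.
  have -> : head x0 (rcons Q1 q) = head x0 (Q1 ++ [:: q, q2 & Q2]) by case: (Q1).
  rewrite Qh; have -> : A ++ q2 :: Q2 != [::] by case: (A) A0.
  have -> : rcons Q1 q ++ rev B != [::] by case: (Q1).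
  move=> /(_ isT) H; suff: 2 < 2 by [].
  by apply: H; perm_count.
have nx A : A \in ps -> A != Q1 ++ [:: q, q2 & Q2] -> A != [::] -> last x0 A != q2.
  move=> Ap AQ A0; apply: contraNneq AQ => E.
  by apply/eqP/(disjoint_paths M Ap Qp (last_mem x0 A0)); rewrite E.
have nPP : last x0 P != last x0 P'.
  apply: contraNneq PP => E.
  by apply/eqP/(disjoint_paths M Pp P'p (last_mem x0 P0)); rewrite E last_mem.
have := claw_freeP e_sym e_irr e_claw
  (v := q) (a := last x0 P) (b := last x0 P') (c := q2).
rewrite ![e q _]e_sym eP eP' -e_sym eqq2.
move=> /(_ isT isT isT nPP (nx _ Pp PQ P0) (nx _ P'p P'Q P'0)) /or3P[] E.
- by case/andP: (ends_nonadjacent e_sym M Pp P'p PP); rewrite E.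
- exact: absurd Pp P'p PP PQ P'Q eP' E.
- by apply: absurd P'p Pp _ P'Q PQ eP E; rewrite eq_sym.
Qed.

(** Rotating [Q] along the edge from its end to [q'] gives a path that ends in [q]; appending [P]
    backwards would merge the two paths. *)
Lemma own_end_and_free_end P Q1 q' q Q2 : P \in ps -> Q1 ++ [:: q', q & Q2] \in ps ->
    P != Q1 ++ [:: q', q & Q2] ->
  e (last q Q2) q' -> ~~ e (last x0 P) q.
Proof.
move=> Pp Qp PQ eQ; apply/negP=> eP.
have /and3P[P0 Ps Pa] := hang Pp; have /and3P[Q0 Qs Qh] := hang Qp.
have QP : Q1 ++ [:: q', q & Q2] != P by rewrite eq_sym.
have [r pE] := pick2 Qp Pp QP.
have := Qs; rewrite -cat_rcons => /cat_sorted2[Q1s Q2s].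
have q0 : rcons Q1 q' != [::] by case: (Q1).
have rq : rev (q :: Q2) != [::] by rewrite rev_nil.
have rP : rev P != [::] by rewrite rev_nil.
have rr : rev (q :: Q2) ++ rev P != [::] by case: (rev _) rq.
have := @size_replace _ _ _ _ _ _ M _ [:: rcons Q1 q' ++ rev (q :: Q2) ++ rev P] _ pE.
rewrite /= /hanging !(sorted_glue e x0) // Q1s !sorted_reverse // Q2s Ps last_rcons.
rewrite !head_glue // !head_rev last_rev /= e_sym eQ [e q _]e_sym eP.
have -> : head x0 (rcons Q1 q') = head x0 (Q1 ++ [:: q', q & Q2]) by case: (Q1).
rewrite Qh; have -> : rcons Q1 q' ++ rev (q :: Q2) ++ rev P != [::] by case: (Q1).
move=> /(_ isT) H; suff: 1 < 1 by [].
by apply: H; perm_count.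
Qed.

(** The same rotation makes [q] the last vertex of the path, and a neighbor of [q] in [R] would then
    lower the number of loose paths. *)
Lemma own_end_and_tree_vertex Q1 q' q Q2 b : Q1 ++ [:: q', q & Q2] \in ps ->
    ~~ attached e R (last q Q2) -> b \in R ->
  e (last q Q2) q' -> ~~ e b q.
Proof.
move=> Qp Ql bR eQ; apply/negP=> eb.
have /and3P[Q0 Qs Qh] := hang Qp.
have pE := pick1 Qp.
have := Qs; rewrite -cat_rcons => /cat_sorted2[Q1s Q2s].
have q0 : rcons Q1 q' != [::] by case: (Q1).
have rq : rev (q :: Q2) != [::] by rewrite rev_nil.
have := @loose_replace _ _ _ _ _ _ M _ [:: rcons Q1 q' ++ rev (q :: Q2)] _ pE.
rewrite /= /hanging !(sorted_glue e x0) // Q1s !sorted_reverse // Q2s last_rcons.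
rewrite !head_glue // !head_rev /= e_sym eQ.
have -> : head x0 (rcons Q1 q') = head x0 (Q1 ++ [:: q', q & Q2]) by case: (Q1).
rewrite Qh; have -> : rcons Q1 q' ++ rev (q :: Q2) != [::] by case: (Q1).
have lE : last x0 (rcons Q1 q' ++ rev (q :: Q2)) = q by rewrite last_glue ?last_rev.
have qR : attached e R q by apply/exists_inP; exists b.
have lQ : last x0 (Q1 ++ [:: q', q & Q2]) = last q Q2 by rewrite last_cat.
rewrite /loose /= lE lQ qR Ql => /(_ isT) H; suff: 1 <= 0 by [].
by apply: H; rewrite ?cats0 // -cat_rcons perm_cat2l perm_rev.
Qed.

End DegreeSum.

(** * The independent set of anchors and the sum of its degrees *)

Lemma splits_path (A : eqType) (r : rel A) h (Q : seq A) :
  (forall Q1 q' q Q2, h :: Q = Q1 ++ [:: q', q & Q2] -> r q' q) -> path r h Q.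
Proof.
elim: Q h => //= q Q IH h H; rewrite (H [::] h q Q) //=.
by apply: IH => Q1 q' q'' Q2 E; apply: (H (h :: Q1) q' q'' Q2); rewrite E.
Qed.

(** The amount [g] of each vertex is moved to its successor, where it adds up with [a] to at most
    one; the last vertex has nothing to move, and the head keeps only [a h]. *)
Lemma sum_path_le (A : eqType) (a g : A -> nat) h (Q : seq A) :
    path (fun q' q => g q' + a q <= 1) h Q -> g (last h Q) = 0 ->
  \sum_(v <- h :: Q) (a v + g v) <= a h + size Q.
Proof.
elim: Q h => [|q Q IH] h /=; first by move=> _ g0; rewrite big_seq1 g0.
case/andP=> H pQ gl; rewrite big_cons; have := IH q pQ gl; lia.
Qed.

Section Counting.

Variables (V : finType) (e : rel V) (x0 : V).
Hypotheses (e_sym : symmetric e) (e_irr : irreflexive e) (e_claw : claw_free e).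
Variables (R : {set V}) (t : rel V) (ps : seq (seq V)).
Hypothesis (M : minimal e x0 R t ps).
Hypothesis (many : 2 < lam t).

Let D := min_dec M.
Let T := dec_tree D.
Let hang := hanging_in M.

Definition pendant_end x :=
  [exists b, leaf t b && has (fun P => (last x0 P == x) && private e x0 R b P) ps].

(** The set to which the degree condition is applied; it may have more than [3 * k + 3] elements,
    and a subset is taken at the end. *)
Definition anchors := [set x | leaf t x || pendant_end x].

Lemma pendant_endP x : pendant_end x -> exists b P,
  [/\ leaf t b, P \in ps, last x0 P = x & private e x0 R b P].
Proof. by case/existsP=> b /andP[lb /hasP[P Pp /andP[/eqP lP pr]]]; exists b, P. Qed.

Lemma pendant_end_notin x : pendant_end x -> x \notin R.
Proof.
case/pendant_endP=> b [P [_ Pp <- _]]; have /and3P[P0 _ _] := hang Pp.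
exact: (path_notin M Pp (last_mem x0 P0)).
Qed.

Lemma pendant_end_isolated x r : pendant_end x -> r \in R -> ~~ e r x.
Proof.
case/pendant_endP=> b [P [lb Pp <- pr]] rR.
exact: (private_last e_sym e_irr e_claw M lb Pp pr rR).
Qed.

Lemma pendant_end_loose x : pendant_end x -> ~~ attached e R x.
Proof.
move=> px; apply/negP=> /exists_inP[r rR erx].
by have := pendant_end_isolated px rR; rewrite erx.
Qed.

Lemma anchors_R x : x \in R -> (x \in anchors) = leaf t x.
Proof.
move=> xR; rewrite inE; case: (boolP (pendant_end x)); last by rewrite orbF.
by move/pendant_end_notin; rewrite xR.
Qed.

Lemma anchors_notR x : x \notin R -> (x \in anchors) = pendant_end x.
Proof.
move=> xR; rewrite inE; case: (boolP (leaf t x)) => // lx.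
by rewrite (leaf_dom T lx) in xR.
Qed.

Lemma free_end_eq P Q : P \in ps -> Q \in ps -> last x0 P = last x0 Q -> P = Q.
Proof.
move=> Pp Qp E; have /and3P[P0 _ _] := hang Pp; have /and3P[Q0 _ _] := hang Qp.
by apply: (disjoint_paths M Pp Qp (last_mem x0 P0)); rewrite E last_mem.
Qed.

Lemma anchors_independent : independent e anchors.
Proof.
apply/forallP=> x; apply/implyP=> xA; apply/forallP=> y; apply/implyP=> yA.
case: (boolP (x \in R)) => xR; case: (boolP (y \in R)) => yR.
- move: xA yA; rewrite !anchors_R // => lx ly.
  exact: (leaves_nonadjacent e_sym e_irr M many lx ly).
- by move: yA; rewrite anchors_notR // => /pendant_end_isolated->.
- by move: xA; rewrite e_sym anchors_notR // => /pendant_end_isolated->.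
move: xA yA; rewrite !anchors_notR // => /pendant_endP[b [P [_ Pp <- _]]].
case/pendant_endP=> b' [P' [_ P'p <- _]].
case: (eqVneq P P') => [->|PP]; first by rewrite e_irr.
by case/andP: (ends_nonadjacent e_sym M Pp P'p PP).
Qed.

(** Each leaf [b] contributes three distinct vertices of [fib b]: itself and the ends of two private
    paths. The fibers are disjoint because the head of a private path determines its leaf. *)
Lemma anchors_card : 3 * lam t <= #|anchors|.
Proof.
pose fib b := [set x in anchors |
  (x == b) || has (fun P => (last x0 P == x) && private e x0 R b P) ps].
have fibP b x : x \in fib b -> x \in R -> x = b.
  rewrite inE => /andP[_ /orP[/eqP //|/hasP[P Pp /andP[/eqP<- _]]]] xR.
  have /and3P[P0 _ _] := hang Pp.
  by have := path_notin M Pp (last_mem x0 P0); rewrite xR.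
have fib3 b : leaf t b -> 3 <= #|fib b|.
  move=> lb; have [P1 [P2 [P1p P2p P12 pr1 pr2]]] := two_private e_sym e_irr M lb.
  have bR := leaf_dom T lb.
  have /and3P[P10 _ _] := hang P1p; have /and3P[P20 _ _] := hang P2p.
  apply: leq_trans (_ : #|b |: (last x0 P1 |: [set last x0 P2])| <= _).
    rewrite !cardsU1 cards1 !inE.
    rewrite !(eq_sym b) (negbTE (path_neq M P1p (last_mem x0 P10) bR)).
    rewrite (negbTE (path_neq M P2p (last_mem x0 P20) bR)) /=.
    by rewrite (contra_neq (free_end_eq P1p P2p) P12).
  apply/subset_leq_card/subsetP=> x; rewrite !inE.
  have pe P : P \in ps -> private e x0 R b P -> x = last x0 P ->
      pendant_end x && has (fun P => (last x0 P == x) && private e x0 R b P) ps.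
    move=> Pp pr ->; apply/andP; split; last first.
      by apply/hasP; exists P; rewrite ?eqxx.
    by apply/existsP; exists b; rewrite lb; apply/hasP; exists P; rewrite ?eqxx.
  case/or3P=> /eqP xE; first by rewrite xE lb eqxx.
    by have /andP[-> ->] := pe _ P1p pr1 xE; rewrite !orbT.
  by have /andP[-> ->] := pe _ P2p pr2 xE; rewrite !orbT.
apply: leq_trans (_ : \sum_(b | leaf t b) #|fib b| <= _).
  rewrite mulnC -sum_nat_const; under eq_bigl => b do rewrite inE.
  by apply: leq_sum => b; apply: fib3.
under eq_bigr => b _ do rewrite -sum1dep_card big_mkcondr /=.
rewrite exchange_big /= -sum1_card; apply: leq_sum => x xA.
rewrite -big_mkcondr /= sum1dep_card; apply/card_le1_eqP => b b'.
rewrite !inE => /andP[lb xb] /andP[lb' xb'].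
have bR := leaf_dom T lb; have b'R := leaf_dom T lb'.
case: (boolP (x \in R)) => xR.
  have inf c : (x == c) || has (fun P => (last x0 P == x) && private e x0 R c P) ps ->
      x = c.
    by move=> H; apply: fibP => //; rewrite inE xA.
  by rewrite -(inf _ xb) -(inf _ xb').
have nx c : c \in R -> (x == c) = false.
  by move=> cR; apply/negbTE; apply: contraNneq xR => ->.
move: xb xb'; rewrite !nx //= => /hasP[P Pp /andP[/eqP lP pr]].
case/hasP=> P' P'p /andP[/eqP lP' pr'].
have PP : P' = P by apply: free_end_eq => //; rewrite lP lP'.
rewrite PP in pr'.
exact: (private_head Pp pr b'R (private_headE M Pp pr')).
Qed.

(** Summed over all [v] this is the degree sum of the anchors, counted from the other end of each
    edge. *)
Definition hits v := #|[set s in anchors | e s v]|.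

(** Each vertex of [R] contributes at most one to the left side: the only anchors adjacent to it are
    leaves, their closed neighborhoods in [R] are disjoint, and a leaf is adjacent to no leaf. *)
Lemma hits_R : \sum_(v in R) hits v + lam t <= #|R|.
Proof.
have -> : lam t = \sum_(v in R) leaf t v.
  rewrite /lam -sum1dep_card big_mkcond [RHS]big_mkcond; apply: eq_bigr => v _.
  by case: (boolP (leaf t v)) => [/(leaf_dom T) -> //|_]; case: ifP.
rewrite -big_split -sum1_card; apply: leq_sum => v vR /=.
have hitE s : s \in [set s in anchors | e s v] -> leaf t s /\ e v s.
  rewrite inE => /andP[sA esv]; rewrite e_sym; split=> //.
  rewrite -anchors_R //; apply/negPn/negP=> sR.
  by move: sA; rewrite anchors_notR // => /pendant_end_isolated/(_ vR); rewrite e_sym esv.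
case: (boolP (leaf t v)) => lv.
  rewrite /hits eq_card0 // => s; apply/negP=> /hitE[ls evs].
  by have := leaves_nonadjacent e_sym e_irr M many lv ls; rewrite evs.
rewrite addn0; apply/card_le1_eqP=> s s' /hitE[ls evs] /hitE[ls' evs'].
apply/eqP/negPn/negP=> ss.
have := leaf_balls_disjoint e_sym e_irr e_claw M many ls' ls _ vR.
by rewrite evs evs' !orbT => /(_ ss).
Qed.

(** Hits by the end of [Q] itself, [g], are charged to the successor and all other hits, [a], to the
    vertex itself; [sum_path_le] adds up the charges. *)
Lemma hits_path Q : Q \in ps -> \sum_(v <- Q) hits v <= size Q.
Proof.
move=> Qp; have /and3P[Q0 _ _] := hang Qp.
pose g v : nat := (last x0 Q \in anchors) && e (last x0 Q) v.
pose a v := #|[set s in anchors | (s != last x0 Q) && e s v]|.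
have hitsE v : hits v = a v + g v.
  rewrite /hits (cardsD1 (last x0 Q)) inE addnC; congr (_ + _).
  by apply: eq_card => s; rewrite !inE andbCA.
have lQR : last x0 Q \notin R := path_notin M Qp (last_mem x0 Q0).
have other s q : s \in anchors -> s != last x0 Q -> e s q -> q \in Q ->
    leaf t s \/ exists P, [/\ P \in ps, P != Q, last x0 P = s &
                             ~~ attached e R (last x0 P)].
  move=> sA sQ esq qQ; case: (boolP (s \in R)) => sR.
    by left; rewrite -anchors_R.
  right; move: sA; rewrite anchors_notR // => ps_s.
  have [b [P [lb Pp lP pr]]] := pendant_endP ps_s.
  exists P; split=> //; last by rewrite lP; apply: pendant_end_loose.
  by apply: contraNneq sQ => <-; rewrite lP.
(* Two anchors adjacent to [q] and different from the end of [Q] are two leaves, a leaf and a free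
   end, or two free ends; an earlier lemma excludes each case. *)
have a1 q : q \in Q -> a q <= 1.
  move=> qQ; apply/card_le1_eqP=> s s'.
  rewrite in_set => /and3P[sA sQ esq]; rewrite in_set => /and3P[s'A s'Q es'q].
  apply/eqP/negPn/negP=> ss.
  have qR : q \notin R := path_notin M Qp qQ.
  have [Q1 [Q2 QE]] : exists Q1 Q2, Q = Q1 ++ q :: Q2.
    by case/splitPr: qQ => Q1 Q2; exists Q1, Q2.
  have oth := other _ q _ _ _ qQ.
  case: (oth s sA sQ esq) => [ls|[P [Pp PQ lP Pl]]];
  case: (oth s' s'A s'Q es'q) => [ls'|[P' [P'p P'Q lP' P'l]]].
  - case/negP: qR.
    exact: (leaves_share_no_outer e_sym e_irr M many ls' ls ss es'q esq).
  - rewrite QE in Qp P'Q; have sR := leaf_dom T ls; rewrite -lP' in es'q.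
    by have := free_end_and_tree_vertex e_sym e_irr e_claw M P'p Qp P'Q P'l sR es'q;
      rewrite esq.
  - rewrite QE in Qp PQ; have sR := leaf_dom T ls'; rewrite -lP in esq.
    by have := free_end_and_tree_vertex e_sym e_irr e_claw M Pp Qp PQ Pl sR esq;
      rewrite es'q.
  - rewrite QE in Qp PQ P'Q; rewrite -lP in esq; rewrite -lP' in es'q.
    have PP : P != P' by apply: contraNneq ss => PP; rewrite -lP -lP' PP.
    by have := two_free_ends e_sym e_irr e_claw M Pp P'p Qp PP PQ P'Q esq; rewrite es'q.
(* If the end of [Q] is an anchor adjacent to [q'], rotating [Q] shows that no other anchor is
   adjacent to [q]; otherwise [a q <= 1] suffices. *)
have ga q' q Q1 Q2 : Q = Q1 ++ [:: q', q & Q2] -> g q' + a q <= 1.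
  move=> QE; have qQ : q \in Q by rewrite QE mem_cat !inE eqxx !orbT.
  have lE : last x0 Q = last q Q2 by rewrite QE last_cat.
  rewrite /g; case: (boolP (_ && _)) => [/andP[lA eq']|_]; last exact: a1.
  rewrite /a eq_card0 // => s; rewrite in_set; apply/negP.
  case/and3P=> sA sQ esq; have lpe : pendant_end (last x0 Q) by rewrite -anchors_notR.
  have Ql := pendant_end_loose lpe; rewrite lE in Ql eq'.
  case: (other s q sA sQ esq qQ) => [ls|[P [Pp PQ lP Pl]]].
    have Qp' := Qp; rewrite QE in Qp'.
    by have := own_end_and_tree_vertex e_sym M Qp' Ql (leaf_dom T ls) eq'; rewrite esq.
  have Qp' := Qp; rewrite QE in Qp' PQ.
  by have := own_end_and_free_end e_sym M Pp Qp' PQ eq'; rewrite lP esq.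
rewrite (eq_bigr _ (fun v _ => hitsE v)).
case QE: Q Q0 => [//|h Q'] _; apply: leq_trans (sum_path_le _ _) _.
- by apply: splits_path => Q1 q' q Q2 E; apply: (ga q' q Q1 Q2); rewrite QE E.
- by rewrite /g QE /= e_irr andbF.
by rewrite /= -addn1 addnC leq_add2l a1 // QE mem_head.
Qed.

Lemma anchors_degree_sum : \sum_(s in anchors) deg e s + lam t <= #|V|.
Proof.
have -> : \sum_(s in anchors) deg e s = \sum_v hits v.
  under eq_bigr => s _ do rewrite /deg -sum1dep_card big_mkcond /=.
  rewrite exchange_big /=; apply: eq_bigr => v _.
  by rewrite -big_mkcondr /= sum1dep_card.
rewrite (bigID (mem R)) /= addnAC.
have -> : \sum_(v | v \notin R) hits v = \sum_(v <- flatten ps) hits v.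
  rewrite (perm_big _ (dec_cover D)) big_enum /=.
  by apply: eq_bigl => v; rewrite inE.
rewrite -(cardsC R); apply: leq_add; first exact: hits_R.
apply: leq_trans (_ : size (flatten ps) <= _); last first.
  by rewrite (perm_size (dec_cover D)) -cardE.
rewrite big_flatten /= size_flatten sumnE big_map.
rewrite big_seq [X in _ <= X]big_seq; apply: leq_sum => Q Qp.
exact: hits_path.
Qed.

End Counting.

(** * Hanging the paths on the tree, and the reducible stem of the result *)

Lemma uniq_split (A : eqType) (x : A) s1 s2 s1' s2' :
    uniq (s1 ++ x :: s2) -> s1 ++ x :: s2 = s1' ++ x :: s2' ->
  s1 = s1' /\ s2 = s2'.
Proof.
move=> us E; have us' := us; rewrite E in us'.
have nin a b : uniq (a ++ x :: b) -> x \notin a.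
  by rewrite cat_uniq => /and3P[_ /norP[]].
have ix a b : uniq (a ++ x :: b) -> index x (a ++ x :: b) = size a.
  by move/nin=> H; rewrite index_cat (negbTE H) /= eqxx addn0.
have sz : size s1 = size s1' by rewrite -(ix _ _ us) -(ix _ _ us') E.
by move/eqP: E; rewrite eqseq_cat // eqseq_cons eqxx => /andP[/eqP-> /eqP->].
Qed.

Lemma mem_zip_shift (A : eqType) (a : A) P x y :
  reflect (exists s1 s2, a :: P = s1 ++ [:: x, y & s2]) ((x, y) \in zip (a :: P) P).
Proof.
apply: (iffP idP).
  elim: P a => //= b P IH a.
  rewrite inE xpair_eqE => /orP[/andP[/eqP-> /eqP->]|/IH[s1 [s2 ->]]].
    by exists [::], P.
  by exists (a :: s1), s2.
elim: P a => [|b P IH] a [s1 [s2]].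
  by case: s1 => [|c [|d s1]].
case: s1 => [|c s1] /= [aE E].
  by case: E => -> _; rewrite aE inE eqxx.
by rewrite inE IH ?orbT //; exists s1, s2.
Qed.

Lemma tree_acyclic (V : finType) (e t : rel V) R :
  irreflexive e -> tree_on e t R -> acyclic t.
Proof.
move=> ei T [|x [|y [|z p]]] // _ /andP[] /=.
case/and3P=> txy tyz pz /and3P[nx ny _].
have /negP[] := tree_bridge ei T txy.
rewrite (sym_connect_sym (del_edge_sym x y (tree_sym T))).
apply/connectP; exists (z :: rcons p x); last by rewrite /= last_rcons.
apply/andP; split.
  rewrite /del_edge tyz /same_pair; apply/negP=> /orP[]/andP[].
    by move=> /eqP E; rewrite E !inE eqxx in nx.
  by move=> _ /eqP E; rewrite E !inE eqxx !orbT in nx.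
apply: path_del_edge => //; apply/orP; right.
rewrite -rcons_cons mem_rcons inE negb_or ny andbT.
by apply: contraNneq nx => ->; rewrite inE eqxx.
Qed.

Lemma tpath_tailP (V : finType) (t : rel V) u v : connect t u v ->
  [/\ path t u (tpath_tail t u v), uniq (u :: tpath_tail t u v)
    & last u (tpath_tail t u v) = v].
Proof.
case/connectP=> p0 pp Ep; case/shortenP: pp Ep => p pp up _ Ep.
rewrite /tpath_tail; case: pickP => [q /and3P[pq uq /eqP lq] //|H].
(* The search ranges over sequences of length at most [#|V|], which include the simple path
   found. *)
have sp : size p <= #|V|.
  by move: (up) => /andP[_ /card_uniqP <-]; apply: max_card.
by have := H (Bseq sp); rewrite pp up -Ep eqxx.
Qed.

Section Unfolding.

Variables (V : finType) (e : rel V) (x0 : V).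
Hypotheses (e_sym : symmetric e) (e_irr : irreflexive e) (e_claw : claw_free e).
Variables (R : {set V}) (t : rel V) (ps : seq (seq V)).
Hypothesis (M : minimal e x0 R t ps).

Let D := min_dec M.
Let T := dec_tree D.
Let hang := hanging_in M.

(** An arbitrary choice of the vertex to which the path is tied; for paths of the cover the default
    is never taken. *)
Definition foot P := odflt x0 [pick r in R | e r (head x0 P)].

Lemma footP P : P \in ps -> foot P \in R /\ e (foot P) (head x0 P).
Proof.
move=> Pp; have /and3P[_ _ /exists_inP[r rR er]] := hang Pp.
rewrite /foot; case: pickP => [r' /andP[] //|/(_ r)].
by rewrite rR er.
Qed.

(** Edges of the paths, each prolonged by its foot and directed away from [R]; zipping a list with
    its tail yields the consecutive pairs. *)
Definition links := flatten [seq zip (foot P :: P) P | P <- ps].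

Definition unfolding : rel V :=
  fun x y => [|| t x y, (x, y) \in links | (y, x) \in links].

Lemma linksP x y : reflect
  (exists P s1 s2, P \in ps /\ foot P :: P = s1 ++ [:: x, y & s2]) ((x, y) \in links).
Proof.
apply: (iffP flattenP) => [[_ /mapP[P Pp ->] /mem_zip_shift[s1 [s2 E]]]|].
  by exists P, s1, s2.
case=> P [s1 [s2 [Pp E]]]; exists (zip (foot P :: P) P); first exact: map_f.
by apply/mem_zip_shift; exists s1, s2.
Qed.

Lemma foot_path_uniq P : P \in ps -> uniq (foot P :: P).
Proof.
move=> Pp; have [fR _] := footP Pp; rewrite /=; apply/andP; split.
  by apply: contraTN fR => /(path_notin M Pp).
have := cover_uniq M; rewrite (perm_uniq (perm_flatten (pick1 Pp))) /=.
by rewrite cat_uniq => /andP[].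
Qed.

Lemma foot_path P : P \in ps -> path e (foot P) P.
Proof.
move=> Pp; have [_] := footP Pp; have /and3P[P0 Ps _] := hang Pp.
by case: (P) P0 Ps => //= a Q _ -> ->.
Qed.

Lemma split_tail P s1 x y s2 : foot P :: P = s1 ++ [:: x, y & s2] -> y \in P.
Proof.
case: s1 => [|a s1] /= [_ ->]; first by rewrite inE eqxx.
by rewrite mem_cat !inE eqxx !orbT.
Qed.

Lemma links_notR x y : (x, y) \in links -> y \notin R.
Proof.
by case/linksP=> P [s1 [s2 [Pp /split_tail yP]]]; apply: (path_notin M Pp yP).
Qed.

Lemma unfolding_sym : symmetric unfolding.
Proof. by move=> x y; rewrite /unfolding (tree_sym T) [X in _ || X]orbC. Qed.

Lemma unfolding_sub : subrel unfolding e.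
Proof.
have sub x y : (x, y) \in links -> e x y.
  case/linksP=> P [s1 [s2 [Pp E]]].
  have : sorted e (foot P :: P) := foot_path Pp.
  by rewrite E sorted_cat_cons /= => /and3P[].
by move=> x y /or3P[/(tree_sub T)|/sub|/sub] //; rewrite e_sym.
Qed.

Lemma unfolding_path P : P \in ps -> path unfolding (foot P) P.
Proof.
move=> Pp; apply: splits_path => Q1 q' q Q2 E.
by rewrite /unfolding; apply/or3P; apply: Or32; apply/linksP; exists P, Q1, Q2.
Qed.

(** Every path reaches [R] through its foot, which gives connectivity. A path has as many links as
    vertices, so the links number [#|~: R|] and fit the edge bound. *)
Lemma unfolding_tree : tree_on e unfolding [set: V].
Proof.
have us := unfolding_sym; have cus := sym_connect_sym us.
have toR x : exists2 r, r \in R & connect unfolding r x.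
  case: (boolP (x \in R)) => xR; first by exists x.
  have : x \in flatten ps by rewrite (cover_mem M).
  case/flattenP=> P Pp xP; exists (foot P); first by case: (footP Pp).
  by apply: (path_connect (unfolding_path Pp)); rewrite inE xP orbT.
split=> //.
- exact: unfolding_sub.
- move=> x y _ _; have [r rR crx] := toR x; have [r' r'R cry] := toR y.
  apply: connect_trans cry; rewrite cus in crx; apply: connect_trans crx _.
  have := tree_conn T rR r'R; apply: connect_sub => a b tab.
  by apply: connect1; rewrite /unfolding tab.
- by rewrite cardsT; apply/card_gt0P; exists x0.
pose swap (p : V * V) := (p.2, p.1).
have sub : edges unfolding \subset
    edges t :|: ([set p in links] :|: [set p in map swap links]).
  apply/subsetP=> -[x y]; rewrite !inE /= => /or3P[->|->|yx]; rewrite ?orbT //.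
  by apply/orP; right; apply/orP; right; apply/mapP; exists (y, x).
have sl : size links = #|~: R|.
  rewrite cardE -(perm_size (dec_cover D)) !size_flatten /shape -!map_comp.
  congr sumn; apply: eq_map => P /=; rewrite size_zip /=; lia.
have cl (s : seq (V * V)) : #|[set p in s]| <= size s by rewrite cardsE card_size.
have := subset_leq_card sub.
have := cardsU (edges t) ([set p in links] :|: [set p in map swap links]).
have := cardsU [set p in links] [set p in map swap links].
have := cl links; have := cl (map swap links); rewrite size_map sl cardsT.
have := tree_card T; have := tree_gt0 T; have := cardsC R.
move: #|edges _| #|edges _| => a b; move: #|_ :|: _| #|_ :|: _| => c d.
move: #|_ :&: _| #|_ :&: _| => a1 a2; move: #|[set _ in _]| #|[set _ in _]| => b1 b2.
clear; lia.
Qed.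

(** Absence of repetitions fixes the position of [v] in the cover, so a link at [v] can only join it
    to its predecessor or successor. *)
Lemma unfolding_nbr P A u v B w : P \in ps -> foot P :: P = A ++ [:: u, v & B] ->
  unfolding v w -> w = u \/ exists B', B = w :: B'.
Proof.
move=> Pp E; have vP := split_tail E; have vR := path_notin M Pp vP.
have uE := foot_path_uniq Pp.
case/or3P=> [/(tree_dom T)|/linksP|/linksP]; first by rewrite (negbTE vR).
  case=> P' [s1 [s2 [P'p E']]]; right; exists s2.
  have vP' : v \in P'.
    have : v \in foot P' :: P' by rewrite E' mem_cat !inE eqxx orbT.
    rewrite inE => /orP[/eqP vE|//]; have [fR _] := footP P'p.
    by rewrite vE fR in vR.
  have PP := disjoint_paths M Pp P'p vP vP'; rewrite -PP E in E'.
  rewrite E -cat_rcons in uE; rewrite -cat_rcons in E'.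
  by case: (uniq_split uE E') => _ ->.
case=> P' [s1 [s2 [P'p E']]]; left.
have PP := disjoint_paths M Pp P'p vP (split_tail E'); rewrite -PP E in E'.
rewrite E -cat_rcons in uE; rewrite -[A ++ _]cat_rcons -[s1 ++ _]cat_rcons in E'.
by case: (uniq_split uE E') => /rcons_inj[_ ->].
Qed.

Lemma split_at P v : v \in P ->
  exists A u B, foot P :: P = A ++ [:: u, v & B].
Proof.
case/splitPr=> P1 P2; case/lastP: P1 => [|P1 u].
  by exists [::], (foot (v :: P2)), P2.
by exists (foot (rcons P1 u ++ v :: P2) :: P1), u, P2; rewrite cat_rcons.
Qed.

Lemma split_unfolding P A u v B : P \in ps -> foot P :: P = A ++ [:: u, v & B] ->
  unfolding v u.
Proof.
by move=> Pp E; apply/or3P; apply: Or33; apply/linksP; exists P, A, B.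
Qed.

Lemma path_deg P v : P \in ps -> v \in P ->
  deg unfolding v <= 2 /\ (deg unfolding v == 1) = (v == last x0 P).
Proof.
move=> Pp vP; have [A [u [B E]]] := split_at vP; have uE := foot_path_uniq Pp.
have vu := split_unfolding Pp E; have nb := unfolding_nbr Pp E.
have lE : last x0 P = last v B.
  have : last x0 (foot P :: P) = last v B by rewrite E last_cat.
  by case: (P) vP.
rewrite lE; case: B E uE nb {lE} => [|w B] E uE nb /=.
  have -> : deg unfolding v = 1.
    apply/eqP/cards1P; exists u; apply/setP=> w; rewrite !inE.
    by apply/idP/eqP=> [/nb[//|[]//]|->].
  by rewrite !eqxx.
have vw : unfolding v w.
  apply/or3P; apply: Or32; apply/linksP; exists P, (rcons A u), B.
  by rewrite cat_rcons.
have uw : u != w.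
  move: uE; rewrite E cat_uniq => /and3P[_ _] /= /andP[].
  by rewrite !inE !negb_or => /and3P[].
have -> : deg unfolding v = 2.
  have -> : 2 = #|[set u; w]| by rewrite cards2 uw.
  apply: eq_card => z; rewrite !inE.
  by apply/idP/orP=> [/nb[->|[B' [->]]]|[]/eqP->] //; rewrite eqxx; [left|right].
split=> //; apply/esym/negbTE; move: uE.
rewrite E -cat_rcons cat_uniq => /and3P[_ _] /= /andP[nv _].
by apply: contraNneq nv => ->; rewrite mem_last.
Qed.

Lemma branch_in_tree v : branch unfolding v -> v \in R.
Proof.
move=> bv; apply/negPn/negP=> vR.
have : v \in flatten ps by rewrite (cover_mem M).
case/flattenP=> P Pp vP; have [d2 _] := path_deg Pp vP.
by move: bv; rewrite /branch leqNgt ltnS d2.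
Qed.

(* A simple path of the unfolding cannot turn around inside a hanging path. *)
Lemma descend P A v B q : P \in ps -> foot P :: P = A ++ v :: B ->
    path unfolding v q -> uniq (v :: q) -> (forall w B', B = w :: B' -> w \notin q) ->
    last v q \in R -> exists q', v :: q = rev (rcons A v) ++ q'.
Proof.
move=> Pp; elim/last_ind: A v B q => [|A u IH] v B q E pq uq nB lR.
  by exists q.
rewrite cat_rcons in E; have vR := path_notin M Pp (split_tail E).
case: q pq uq nB lR => [|w q] /= pq uq nB lR; first by rewrite (negbTE vR) in lR.
case/andP: pq => vw pq; case/and3P: uq => nv nw uq.
have wu : w = u.
  case: (unfolding_nbr Pp E vw) => // -[B' BE].
  by have := nB _ _ BE; rewrite inE eqxx.
rewrite {}wu in vw pq nv nw lR nB *.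
have [||q' q'E] := IH u (v :: B) q E pq _ _ lR.
- by rewrite /= nw.
- by move=> _ _ [<- _]; move: nv; rewrite inE negb_or => /andP[].
by exists q'; rewrite q'E [rev (rcons (rcons _ _) _)]rev_rcons.
Qed.

(** By [descend] the path has to traverse all of [P] backwards and leave it through the foot. *)
Lemma tpath_from_end P y : P \in ps -> y \in R ->
  exists q', tpath unfolding (last x0 P) y = rev P ++ foot P :: q'
             /\ last (foot P) q' = y.
Proof.
move=> Pp yR; have /and3P[P0 _ _] := hang Pp.
have [|pp up lp] := @tpath_tailP _ unfolding (last x0 P) y.
  by apply: (tree_conn unfolding_tree); rewrite inE.
have E : foot P :: P = belast (foot P) P ++ [:: last x0 P].
  by rewrite lastI cats1; case: (P) P0.
have [||q' q'E] := descend Pp E pp up.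
- by [].
- by rewrite lp.
- exists q'; move: q'E; rewrite -cats1 -E rev_cons cat_rcons => q'E.
  split=> //; rewrite -[RHS]lp -[last (last x0 P) _]/(last x0 (last x0 P :: _)) q'E.
  by rewrite last_cat.
Qed.

Lemma end_leaf P : P \in ps -> leaf unfolding (last x0 P).
Proof.
move=> Pp; have /and3P[P0 _ _] := hang Pp.
by have [_] := path_deg Pp (last_mem x0 P0); rewrite eqxx /leaf.
Qed.

Lemma nearest_branch_exists x y : branch unfolding y ->
  exists z, nearest_branch unfolding x z.
Proof.
move=> by_; case: (arg_minnP (tdist unfolding x) by_) => z bz H.
by exists z; rewrite /nearest_branch bz; apply/forallP=> w; apply/implyP/H.
Qed.

(** All branch vertices are in [R], so a vertex of a hanging path lies on the way from the end of
    that path to the nearest of them and is removed. *)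
Lemma stem_sub : reducible_stem unfolding \subset R.
Proof.
rewrite /reducible_stem; case: ifP => [/existsP[y0 by0]|_]; last exact: sub0set.
apply/subsetP=> v; rewrite inE => /andP[nv _]; apply/negPn/negP=> vR.
have : v \in flatten ps by rewrite (cover_mem M).
case/flattenP=> P Pp vP; case/negP: nv; apply/bigcupP.
exists (last x0 P); first exact: end_leaf.
rewrite inE; have [y ny] := nearest_branch_exists (last x0 P) by0.
have /andP[/branch_in_tree yR _] := ny.
apply/existsP; exists y; rewrite ny /=.
have [q' [-> _]] := tpath_from_end Pp yR.
rewrite mem_cat mem_rev vP /=; apply: contraNneq vR => ->; exact: yR.
Qed.

Section Branching.

Hypothesis R_gt1 : 1 < #|R|.

Lemma tree_nonleaf v : v \in R -> ~~ leaf t v -> 1 < deg t v.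
Proof.
move=> vR; rewrite /leaf => nl; rewrite ltn_neqAle eq_sym nl /=.
have [w] : exists w, w \in R :\ v.
  by apply/card_gt0P; have := cardsD1 v R; rewrite vR; move: R_gt1; lia.
rewrite !inE => /andP[wv wR].
have [||a [b [/set1P-> _ tvb]]] := @connect_exit _ t [set v] v w (tree_conn T vR wR).
- by rewrite set11.
- by rewrite inE.
by apply/card_gt0P; exists b; rewrite inE.
Qed.

Lemma deg_foot P : P \in ps -> deg t (foot P) + 1 <= deg unfolding (foot P).
Proof.
move=> Pp; have /and3P[P0 _ _] := hang Pp; have hP := head_mem x0 P0.
have hR := path_notin M Pp hP.
apply: leq_trans (_ : #|head x0 P |: [set y | t (foot P) y]| <= _).
  rewrite cardsU1 inE addnC leq_add2r lt0b; apply: contra hR => /(tree_domr T) //.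
apply/subset_leq_card/subsetP=> y; rewrite !inE => /orP[/eqP->|ty].
  have := unfolding_path Pp; case: (P) P0 => //= a Q _ /andP[//].
by rewrite /unfolding ty.
Qed.

Lemma private_foot b P : P \in ps -> private e x0 R b P -> foot P = b.
Proof. by move=> Pp pr; have [fR ef] := footP Pp; exact: (private_head Pp pr fR ef). Qed.

(** A leaf of [t] keeps its tree neighbor and gains the heads of two private paths, which can only
    be tied to it. *)
Lemma deg_tree_vertex v : v \in R ->
  1 < deg unfolding v /\ (leaf t v -> branch unfolding v).
Proof.
move=> vR; case: (boolP (leaf t v)) => lv; last first.
  split=> //; apply: leq_trans (tree_nonleaf vR lv) _; apply/subset_leq_card.
  by apply/subsetP=> y; rewrite !inE /unfolding => ->.
suff d3 : 2 < deg unfolding v by split=> //; apply: ltnW.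
have [P1 [P2 [P1p P2p P12 pr1 pr2]]] := two_private e_sym e_irr M lv.
have [f tvf _] := leaf_nbr lv; have fR := tree_domr T tvf.
have /and3P[P10 _ _] := hang P1p; have /and3P[P20 _ _] := hang P2p.
apply: leq_trans (_ : #|f |: (head x0 P1 |: [set head x0 P2])| <= _).
  rewrite !cardsU1 cards1 !inE !(eq_sym f).
  rewrite (negbTE (path_neq M P1p (head_mem x0 P10) fR)).
  rewrite (negbTE (path_neq M P2p (head_mem x0 P20) fR)) /=.
  rewrite (contra_neq _ P12) // => E.
  by apply: (disjoint_paths M P1p P2p (head_mem x0 P10)); rewrite E head_mem.
have hd P : P \in ps -> private e x0 R v P -> unfolding v (head x0 P).
  move=> Pp pr; have /and3P[P0 _ _] := hang Pp.
  rewrite -{1}(private_foot Pp pr); have := unfolding_path Pp.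
  by case: (P) P0 => //= a Q _ /andP[].
apply/subset_leq_card/subsetP=> y; rewrite !inE.
case/or3P=> /eqP->; [by rewrite /unfolding tvf | exact: hd | exact: hd].
Qed.

(** A foot that is a leaf of [t] has its private paths; any other has degree at least two in [t] and
    gains the head of [P]. *)
Lemma foot_branch P : P \in ps -> branch unfolding (foot P).
Proof.
move=> Pp; have [fR _] := footP Pp; have [_ H] := deg_tree_vertex fR.
case: (boolP (leaf t (foot P))) => lf; first exact: H.
have := deg_foot Pp; have := tree_nonleaf fR lf; rewrite /branch; lia.
Qed.

Lemma leaf_is_end x : leaf unfolding x -> exists2 P, P \in ps & x = last x0 P.
Proof.
move=> lx; case: (boolP (x \in R)) => xR.
  by have [d _] := deg_tree_vertex xR; move: lx; rewrite /leaf; move: d; case: deg => [|[]].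
have : x \in flatten ps by rewrite (cover_mem M).
case/flattenP=> P Pp xP; exists P => //; have [_ E] := path_deg Pp xP.
by apply/eqP; rewrite -E.
Qed.

(** A leaf [x] of the unfolding ends some hanging path [P], and every route from it into [R] first
    meets the foot, a branch vertex. So the nearest branch vertex is the foot, and only vertices of
    [P] are removed. *)
Lemma sub_stem : [exists y, branch unfolding y] -> R \subset reducible_stem unfolding.
Proof.
rewrite /reducible_stem => ex; rewrite ex; apply/subsetP=> v vR.
rewrite !inE andbT; apply/negP=> /bigcupP[x lx]; rewrite inE.
case/existsP=> y /and3P[/andP[by_ /forallP near] vp vy].
have [P Pp xE] := leaf_is_end lx; have yR := branch_in_tree by_.
have bf := foot_branch Pp; have [fR _] := footP Pp.
have [q [qE lq]] := tpath_from_end Pp yR.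
have [q' [q'E lq']] := tpath_from_end Pp fR.
have q'0 : q' = [::].
  have [|_ uq _] := @tpath_tailP _ unfolding (last x0 P) (foot P).
    by apply: (tree_conn unfolding_tree); rewrite inE.
  move: uq; rewrite -/(tpath unfolding (last x0 P) (foot P)) q'E cat_uniq.
  case/and3P=> _ _ /=; case: (q') lq' => //= a s <-.
  by rewrite mem_last.
have := near (foot P); rewrite bf /= xE /tdist.
have := congr1 size qE; have := congr1 size q'E.
rewrite q'0 /tpath /= !size_cat /= !addnS => -[->] [->].
rewrite leq_add2l leqn0 size_eq0 => /eqP q0.
move: vp; rewrite xE qE q0 mem_cat mem_rev inE; rewrite q0 /= in lq.
case/orP=> [/(path_notin M Pp)|]; first by rewrite vR.
by rewrite lq (negbTE vy).
Qed.

End Branching.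

(** The stem is [R] or trivial, and inside [R] the unfolding coincides with [t], so leaves of the
    stem are leaves of [t]. *)
Lemma stem_leaves : #|leaves_in unfolding (reducible_stem unfolding)| <= lam t.
Proof.
(* If [R] has one vertex, the stem is contained in it and has no vertex of degree one. *)
case: (ltnP 1 #|R|) => R1; last first.
  rewrite [X in X <= _]eq_card0 // => v; rewrite inE; apply/negP=> /andP[vS].
  rewrite eq_card0 // => w; rewrite inE; apply/negP=> /andP[wS].
  have := card_le1_eqP R1 _ _ (subsetP stem_sub _ vS) (subsetP stem_sub _ wS).
  by move=> ->; move=> /unfolding_sub; rewrite e_irr.
case: (boolP [exists y, branch unfolding y]) => ex; last first.
  rewrite /reducible_stem (negbTE ex) [X in X <= _]eq_card0 // => v.
  by rewrite !inE.
have -> : reducible_stem unfolding = R.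
  by apply/eqP; rewrite eqEsubset stem_sub sub_stem.
apply/subset_leq_card/subsetP=> v; rewrite !inE => /andP[vR /eqP d].
rewrite /leaf -d; apply/eqP/eq_card=> w; rewrite !inE.
case: (boolP (w \in R)) => wR /=.
  rewrite /unfolding; case: (boolP (_ \in links)) => [/links_notR|_].
    by rewrite wR.
  case: (boolP (_ \in links)) => [/links_notR|_]; first by rewrite vR.
  by rewrite !orbF.
by apply: contraNF wR => /(tree_domr T).
Qed.

End Unfolding.

(** * Few leaves give the spanning tree; many contradict the degree condition *)

Theorem theorem1p10 (V : finType) (e : rel V) (k : nat) :
  simple_graph e ->
  connected_graph e ->
  claw_free e ->
  2 <= k ->
  ((#|V|%:Z - k%:Z)%R%:E <= sigma e (3 * k + 3))%E ->
  exists t : rel V,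
    spanning_tree e t /\ #|leaves_in t (reducible_stem t)| <= k.
Proof.
move=> [es ei] [V0 conn] cf k2 sig.
have [t0 T0] := spanning_tree_exists es ei V0 conn.
have [x0 _] : exists x, x \in V by apply/card_gt0P.
have D0 : decomposition e x0 [set: V] t0 [::].
  by split=> //=; rewrite setCT enum_set0.
have [R [t [ps M]]] := minimal_exists D0.
case: (leqP (lam t) k) => lk.
  have T := unfolding_tree es M.
  exists (unfolding e x0 R t ps); split; last first.
    exact: leq_trans (stem_leaves es ei M) lk.
  split; last exact: tree_sub T.
  split.
  - by split; [exact: tree_sym T | apply: (tree_irr ei T)].
  - by split=> // x y; apply: (tree_conn T); rewrite inE.
  - exact: tree_acyclic ei T.
(* Since [k] is at least two, more than [k] leaves means at least three, as the exchange arguments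
   require. *)
have l3 : 2 < lam t by apply: leq_ltn_trans lk.
(* [lam t] is at least [k + 1], so there are at least [3 * k + 3] anchors, of which exactly that
   many are kept for [sigma]. *)
have [s [us ss sA]] : exists s, [/\ uniq s, size s = 3 * k + 3 &
    {subset s <= anchors e x0 R t ps}].
  apply/card_geqP; apply: leq_trans (anchors_card es ei M).
  by rewrite addnC -mulnS leq_mul2l lk orbT.
have indS : independent e [set x in s].
  have /forallP ind := anchors_independent es ei cf M l3.
  apply/forallP=> x; apply/implyP; rewrite inE => /sA xA.
  apply/forallP=> y; apply/implyP; rewrite inE => /sA yA.
  by have /implyP/(_ xA)/forallP/(_ y)/implyP/(_ yA) := ind x.
have sumS : \sum_(x in [set x in s]) deg e x <= \sum_(x in anchors e x0 R t ps) deg e x.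
  rewrite [X in _ <= X](big_setID [set x in s]) /=.
  rewrite (setIidPr _) ?leq_addr //.
  by apply/subsetP=> x; rewrite inE => /sA.
have := anchors_degree_sum es ei cf M l3.
have : (sigma e (3 * k + 3) <= ((\sum_(x in [set x in s]) deg e x)%N%:Z)%:E)%E.
  apply: Order.TotalTheory.bigmin_le_cond; rewrite indS cardsE; apply/eqP.
  by rewrite (card_uniqP us).
(* The degree sum is at least [#|V| - k] by hypothesis and at most [#|V| - lam t], which is
   smaller. *)
move/(Order.POrderTheory.le_trans sig); rewrite lee_fin; lia.
Qed.
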